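(* Let $n\ge2$, $\gamma\ge1$, $\rho_+>0$. For $\kappa>0$ and $\rho_b\in\mathbb{R}$, let $\tilde\rho^\kappa(r)$ be a unique stationary solution to the impermeable wall problem, i.e. satisfying $$P(\tilde\rho^\kappa)_r=\kappa\,\tilde\rho^\kappa\left(\tilde\rho^\kappa_{rr}+\frac{n-1}{r}\tilde\rho^\kappa_r\right)_r,\quad r>1,\qquad \tilde\rho^\kappa_r(1)=\rho_b,\qquad \lim_{r\to\infty}\tilde\rho^\kappa(r)=\rho_+ .$$ (1) (Fixed capillarity boundary condition) If $\rho_b$ is a fixed constant for all $\kappa>0$, then there exists a positive constant $C$ that is independent of $\kappa$ such that $$\|\tilde\rho^\kappa-\rho_+\|_{L^2_r(1,\infty)}\le C\kappa^{3/4},\quad \|\tilde\rho^\kappa_r\|_{L^2_r(1,\infty)}\le C\kappa^{1/4},\quad \|\tilde\rho^\kappa-\rho_+\|_{L^\infty(1,\infty)}\le C\kappa^{1/2}.$$ (2) (Singularly scaled capillarity boundary condition) If $\rho_b=\rho_b^0/\sqrt\kappa$ for some sufficiently small fixed $\rho_b^0$, then there exists a unique solution $\bar\rho$ to $$\bar\rho_{yy}=h(\bar\rho)-h(\rho_+),\qquad \bar\rho_y(0)=\rho_b^0,\qquad \lim_{y\to\infty}\bar\rho(y)=\rho_+ .$$ Moreover, let $\bar\rho^\kappa(r):=\bar\rho\left(\frac{r-1}{\sqrt\kappa}\right)$. Then there exists a positive constant $C$ that is independent of $\kappa$ such that $$\|\tilde\rho^\kappa-\bar\rho^\kappa\|_{L^2_r(1,\infty)}\le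 C\kappa^{3/4},\quad \|(\tilde\rho^\kappa-\bar\rho^\kappa)_r\|_{L^2_r(1,\infty)}\le C\kappa^{1/4},\quad \|\tilde\rho^\kappa-\bar\rho^\kappa\|_{L^\infty(1,\infty)}\le C\kappa^{1/2}.$$
   Context: Subscripts $r$, $y$ denote derivatives; $r\in[1,\infty)$ and $y\in[0,\infty)$. The pressure is $P(\rho)=\rho^\gamma$ with fixed $\gamma\ge1$, and $h$ is defined for $\rho>0$ by $h(\rho)=\frac{\gamma}{\gamma-1}\rho^{\gamma-1}$ if $\gamma>1$ and $h(\rho)=\log\rho$ if $\gamma=1$, so that $h'(\rho)=P'(\rho)/\rho$. The weighted norm of a function on $[1,\infty)$ is $$\|f\|_{L^2_r(1,\infty)}:=\left(\int_1^\infty|f(r)|^2r^{n-1}\,dr\right)^{1/2}.$$ The stationary problem is that of the spherically symmetric compressible Navier--Stokes--Korteweg equations outside the unit ball of $\mathbb{R}^n$ with zero velocity (impermeable wall); $\tilde\rho^\kappa$ is the density, $\kappa>0$ is the capillarity coefficient, and $\rho_+$ is the far-field density. The theorem concerns the vanishing capillarity limit $\kappa\to0$.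
   Formalization: In part (2) the constant C is uniform over 0<κ≤κ_max for every κ_max>0 (and may depend on κ_max), since uniformity over all κ>0 fails for n≥4 and ρ_b^0≠0: the layer's weighted L² norm grows like κ^{n/4}. *)

(* Defs.v *)
From HB Require Import structures.
From mathcomp Require Import all_boot all_order all_algebra.
From mathcomp Require Import all_classical all_reals all_analysis.
Set Implicit Arguments.
Unset Strict Implicit.
Unset Printing Implicit Defensive.
Import Order.TTheory GRing.Theory Num.Theory.
Import numFieldNormedType.Exports.
Local Open Scope ring_scope.
Local Open Scope classical_set_scope.

Definition pressure (R : realType) (gamma rho : R) : R := rho `^ gamma.

Definition enthalpy (R : realType) (gamma rho : R) : R :=
  if gamma == 1 then ln rho
  else gamma / (gamma - 1) * rho `^ (gamma - 1).

(* Functions on a half-line [a, +oo[ are represented by total functions R -> R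
   whose values left of a are irrelevant, so the derivative at the endpoint a
   has to be the one-sided one. *)
Definition is_right_derive (R : realType) (f : R -> R) (a l : R) : Prop :=
  (f (a + t) - f a) / t @[t --> 0^'+] --> l.

Definition thrice_derivable (R : realType) (f : R -> R) (x : R) : Prop :=
  [/\ derivable f x 1, derivable (f^`()) x 1 & derivable (f^`(2)) x 1].

Definition radial_laplacian (R : realType) (n : nat) (f : R -> R) (r : R) : R :=
  f^`(2)%classic r + n.-1%:R / r * f^`()%classic r.

(* Both the smooth-solution requirement and the positivity of the density are
   part of the notion of solution.  Continuity of the third derivative follows
   from the equation, and continuity at r = 1 from the boundary condition. *)
Definition stationary_solution (R : realType) (n : nat)
    (gamma rho_plus kappa rho_b : R) (rho : R -> R) : Prop :=
  [/\ forall r : R, 1 <= r -> 0 < rho r,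
      forall r : R, 1 < r -> thrice_derivable rho r,
      forall r : R, 1 < r ->
        (fun s => pressure gamma (rho s))^`() r =
        kappa * rho r * (radial_laplacian n rho)^`()%classic r,
      is_right_derive rho 1 rho_b
    & rho r @[r --> +oo] --> rho_plus].

Definition layer_solution (R : realType) (gamma rho_plus rho_b0 : R)
    (rhobar : R -> R) : Prop :=
  [/\ forall y : R, 0 <= y -> 0 < rhobar y,
      forall y : R, 0 < y -> derivable rhobar y 1 /\ derivable (rhobar^`()) y 1,
      forall y : R, 0 < y ->
        rhobar^`(2) y = enthalpy gamma (rhobar y) - enthalpy gamma rho_plus,
      is_right_derive rhobar 0 rho_b0
    & rhobar y @[y --> +oo] --> rho_plus].

Definition rescaled_layer (R : realType) (kappa : R) (rhobar : R -> R)
    (r : R) : R := rhobar ((r - 1) / Num.sqrt kappa).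

Local Open Scope ereal_scope.

Definition L2r_norm (R : realType) (n : nat) (f : R -> R) : \bar R :=
  (\int[@lebesgue_measure R]_(r in `]1%R, +oo[)
     (`|f r| ^+ 2 * r ^+ n.-1)%:E) `^ 2^-1.

Definition Linfty_norm (R : realType) (f : R -> R) : \bar R :=
  'N[mrestr (@lebesgue_measure R) (measurable_itv `]1, +oo[%R)]_(+oo)
    [EFin \o f].

(* Main.v *)
Require Import Defs.
From HB Require Import structures.
From mathcomp Require Import all_boot all_order all_algebra.
From mathcomp Require Import all_classical all_reals all_analysis.
From mathcomp Require Import measurable_realfun ess_sup_inf.
From mathcomp Require Import ring lra.
Import Order.TTheory GRing.Theory Num.Theory.
Import numFieldNormedType.Exports.
Local Open Scope ring_scope.
Local Open Scope classical_set_scope.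
Set Implicit Arguments.
Unset Strict Implicit.
Unset Printing Implicit Defensive.

(** Integrating the stationary equation once gives
    [kappa * (rho'' + (n - 1) / r * rho') = h(rho) - h(rho_plus)], the constant
    being fixed by the limit at infinity.  Write [u = rho - rho_plus].  The
    moment [r ^ (n - 1) u u'] is nondecreasing and cannot become positive, since
    [u ^ 2] would then stay away from [0]; hence [r ^ (n - 1) |u'|] is
    nonincreasing, and bounded by [|rho_b|].  The energy
    [kappa u' ^ 2 / 2 - H(rho)], with [H' = h - h(rho_plus)], decreases to a
    nonnegative limit, which bounds [u] pointwise; integrating the derivative of
    the moment bounds the weighted norms.  For large [kappa] the pointwise bound
    is taken at [r = sqrt kappa] and transported inwards by the bound on [u'].

    In the singularly scaled case the layer equation is reduced to
    [z' = - sqrt (2 H)] and solved by separation of variables, with exponential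
    decay.  The same moment computation for the difference of [rho] and the layer
    has as only forcing the curvature term of the layer, of size [sqrt kappa]
    after integration.

    Integrals are bounded without computing them, by exhibiting a function whose
    derivative dominates the integrand and whose increments are bounded. *)

(** * Calculus on half-lines *)

Section calculus.
Variable R : realType.
Implicit Types (f g df dg p dq F dF : R -> R) (a b x r s t : R).

Lemma derD f g x a b : is_derive x 1 f a -> is_derive x 1 g b ->
  is_derive x 1 (fun y => f y + g y) (a + b).
Proof. by move=> ? ?; exact: is_deriveD. Qed.

Lemma derB f g x a b : is_derive x 1 f a -> is_derive x 1 g b ->
  is_derive x 1 (fun y => f y - g y) (a - b).
Proof. by move=> ? ?; exact: is_deriveB. Qed.

Lemma derM f g x a b : is_derive x 1 f a -> is_derive x 1 g b ->
  is_derive x 1 (fun y => f y * g y) (a * g x + f x * b).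
Proof.
move=> fa gb; have := is_deriveM fa gb.
by rewrite /GRing.scale/= addrC (mulrC a).
Qed.

Lemma derX f n x a : is_derive x 1 f a ->
  is_derive x 1 (fun y => f y ^+ n.+1) (n.+1%:R * f x ^+ n * a).
Proof.
move=> fa; rewrite (_ : (fun y => _) = f ^+ n.+1); first exact: is_deriveX.
by apply/funext => y; rewrite exprfctE.
Qed.

Lemma derZ f (c : R) x a : is_derive x 1 f a ->
  is_derive x 1 (fun y => c * f y) (c * a).
Proof. by move=> fa; exact: is_deriveZ. Qed.

Lemma der_comp f g x a b : is_derive (f x) 1 g b -> is_derive x 1 f a ->
  is_derive x 1 (fun y => g (f y)) (b * a).
Proof. by move=> gb fa; exact: is_derive1_comp. Qed.

Lemma der_id x : is_derive x 1 (fun y : R => y) 1.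
Proof. exact: is_derive_id. Qed.

Lemma der_cst (c x : R) : is_derive x 1 (fun _ : R => c) 0.
Proof. exact: is_derive_cst. Qed.

Lemma derE f x a b : is_derive x 1 f a -> a = b -> is_derive x 1 f b.
Proof. by move=> ? <-. Qed.

Lemma der_affine (c d x : R) : is_derive x 1 (fun y => (y - c) * d) d.
Proof.
apply: (derE (derM (derB (der_id x) (der_cst c x)) (der_cst d x))).
by rewrite mulr0 addr0 subr0 mul1r.
Qed.

Lemma der_continuous {f x a} : is_derive x 1 f a -> {for x, continuous f}.
Proof.
move=> fa; apply: differentiable_continuous; apply/derivable1_diffP.
exact: ex_derive.
Qed.

Lemma mean_value f df s t : s < t ->
  (forall x, s <= x <= t -> is_derive x 1 f (df x)) ->
  exists2 c, s < c < t & f t - f s = df c * (t - s).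
Proof.
move=> st fdf; have [||c] := @MVT _ f df s t st.
- by move=> x; rewrite in_itv/= => /andP[sx xt]; apply: fdf; rewrite !ltW.
- apply: derivable_within_continuous => x; rewrite in_itv/= => sxt.
  by have := fdf _ sxt => ?; exact: ex_derive.
- by rewrite in_itv/= => ? ?; exists c.
Qed.

Lemma derive_ge0_le f df a : (forall x, a < x -> is_derive x 1 f (df x)) ->
  (forall x, a < x -> 0 <= df x) ->
  forall s t, a < s -> s <= t -> f s <= f t.
Proof.
move=> fdf df0 s t as_; rewrite le_eqVlt => /predU1P[->//|st].
have [x /andP[sx _]|c /andP[sc _] /eqP] := @mean_value f df _ _ st.
  by apply: fdf; exact: lt_le_trans sx.
rewrite subr_eq => /eqP ->; rewrite lerDr mulr_ge0 ?subr_ge0 ?(ltW st)//.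
by apply: df0; exact: lt_trans sc.
Qed.

Lemma derive_le0_ge f df a : (forall x, a < x -> is_derive x 1 f (df x)) ->
  (forall x, a < x -> df x <= 0) ->
  forall s t, a < s -> s <= t -> f t <= f s.
Proof.
move=> fdf df0 s t as_ st; rewrite -lerN2.
apply: (@derive_ge0_le (fun x => - f x) (fun x => - df x) a) => // x ax.
- by have := fdf x ax => ?; exact: is_deriveN.
- by rewrite oppr_ge0 df0.
Qed.

Lemma cvg_at_right_distP f a (l : R) : f t @[t --> a^'+] --> l <->
  forall e : R, 0 < e -> exists2 d : R, 0 < d & forall t, a < t < a + d -> `|f t - l| < e.
Proof.
split=> [/cvgrPdist_lt fl e /fl|fl].
  move=> -[d/= d0 fd]; exists d => // t /andP[at_ td].
  rewrite distrC; apply: fd => //=; rewrite distrC ger0_norm ?subr_ge0 ?ltW//.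
  lra.
apply/cvgrPdist_lt => e /fl[d d0 fd]; near=> t; rewrite distrC; apply: fd.
apply/andP; split=> //; near: t.
by apply: nbhs_right_lt; rewrite ltrDl.
Unshelve. all: by end_near. Qed.

Lemma cvg_pinfty_distP f (l : R) : f t @[t --> +oo] --> l <->
  forall e : R, 0 < e -> exists A : R, forall t, A < t -> `|f t - l| < e.
Proof.
split=> [/cvgrPdist_lt fl e /fl|fl].
  move=> -[A [_ fA]]; exists A => t /fA; by rewrite distrC.
apply/cvgrPdist_lt => e /fl[A fA]; near=> t; rewrite distrC; apply: fA.
by near: t; apply: nbhs_pinfty_gt; exact: num_real.
Unshelve. all: by end_near. Qed.


Lemma cvg_sqr {T : Type} (F : set_system T) {FF : Filter F} (h : T -> R) (l : R) :
  h t @[t --> F] --> l -> h t ^+ 2 @[t --> F] --> l ^+ 2.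
Proof.
by move=> hl; rewrite expr2; under eq_cvg do rewrite expr2; exact: cvgM.
Qed.

(** Boundary data enter the monotonicity arguments as one-sided limits, so interior bounds are read
    off from the limit and not from the value of [f] at [a]. *)
Lemma nonincreasing_le_right f a (l : R) :
  (forall s t, a < s -> s <= t -> f t <= f s) -> f t @[t --> a^'+] --> l ->
  forall r, a < r -> f r <= l.
Proof.
move=> fd /cvg_at_right_distP fl r ar; apply/ler_addgt0Pr => e /fl[d d0 fde].
pose t := Num.min r (a + d / 2).
have : a < t < a + d.
  by rewrite lt_min gt_min ar/=; apply/andP; split; [lra|apply/orP; right; lra].
move=> atd; have := fde _ atd; rewrite ltr_norml => /andP[_].
have /fd : a < t by case/andP: atd.
move=> /(_ r); rewrite ge_min lexx => /(_ isT); lra.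
Qed.

Lemma nondecreasing_ge_right f a (l : R) :
  (forall s t, a < s -> s <= t -> f s <= f t) -> f t @[t --> a^'+] --> l ->
  forall r, a < r -> l <= f r.
Proof.
move=> fd fl r ar; rewrite -lerN2.
apply: (@nonincreasing_le_right (fun x => - f x) a) => //.
- by move=> s t as_ st; rewrite lerN2 fd.
- exact: cvgN.
Qed.

Lemma nonincreasing_ge_pinfty f a (l : R) :
  (forall s t, a < s -> s <= t -> f t <= f s) -> f t @[t --> +oo] --> l ->
  forall r, a < r -> l <= f r.
Proof.
move=> fd /cvg_pinfty_distP fl r ar; apply/ler_addgt0Pr => e /fl[A fA].
have := fA (Num.max r (A + 1)); rewrite lt_max ltrDl ltr01 orbT => /(_ isT).
rewrite ltr_norml => /andP[+ _].
have := fd _ (Num.max r (A + 1)) ar; rewrite le_max lexx => /(_ isT); lra.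
Qed.

Lemma nondecreasing_le_pinfty f a (l : R) :
  (forall s t, a < s -> s <= t -> f s <= f t) -> f t @[t --> +oo] --> l ->
  forall r, a < r -> f r <= l.
Proof.
move=> fd fl r ar; rewrite -lerN2.
apply: (@nonincreasing_ge_pinfty (fun x => - f x) a) => //.
- by move=> s t as_ st; rewrite lerN2 fd.
- exact: cvgN.
Qed.

End calculus.

(** * Continuity of derivatives up to the boundary point *)

Section limits.
Variable R : realType.
Implicit Types (f df p dq : R -> R) (a b x r s t : R).

Lemma is_right_deriveP f a (l : R) : is_right_derive f a l ->
  forall e : R, 0 < e -> exists2 d : R, 0 < d &
    forall t, a < t < a + d -> `|(f t - f a) / (t - a) - l| < e.
Proof.
move=> /cvg_at_right_distP fl e /fl[d d0 fd]; exists d => // t /andP[at_ td].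
have := fd (t - a); rewrite [a + _]addrC subrK; apply.
by rewrite subr_gt0 at_ add0r ltrBlDl.
Qed.

Lemma is_right_derive_cvg f a (l : R) : is_right_derive f a l ->
  f t @[t --> a^'+] --> f a.
Proof.
move=> /is_right_deriveP fl; apply/cvg_at_right_distP => e e0.
have [d d0 fd] := fl 1 ltr01.
have l1 : 0 < `|l| + 1 by rewrite ltr_wpDl.
exists (Num.min d (e / (`|l| + 1))); first by rewrite lt_min d0 divr_gt0.
move=> t /andP[at_]; rewrite -ltrBlDl lt_min => /andP[td te].
have ta : 0 < t - a by rewrite subr_gt0.
have : `|(f t - f a) / (t - a)| < `|l| + 1.
  have := fd t; rewrite at_ -ltrBlDl td => /(_ isT) h.
  have := ler_normD ((f t - f a) / (t - a) - l) l; rewrite subrK; lra.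
rewrite normrM normfV (gtr0_norm ta) ltr_pdivrMr// => /lt_le_trans; apply.
by rewrite -ler_pdivlMl// mulrC ltW.
Qed.

(** The boundary condition gives a limit of difference quotients, not of derivatives. The mean value
    theorem supplies points where the derivative is close to [l], and the bound on [dq] carries this
    to every nearby point. The weight [p] is [r ^ (n - 1)] for the stationary flux and 1 for the
    layer. *)
Lemma right_derivative_cvg f df p dq a (l d B : R) : 0 < d ->
  is_right_derive f a l ->
  (forall r, a < r -> is_derive r 1 f (df r)) ->
  p t @[t --> a^'+] --> (1 : R) ->
  (forall r, a < r -> is_derive r 1 (fun t => p t * df t) (dq r)) ->
  (forall r, a < r < a + d -> `|dq r| <= B) ->
  df t @[t --> a^'+] --> l.
Proof.
move=> d0 fl fdf p1 qdq dqB.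
have B0 : 0 <= B.
  by apply: le_trans (dqB (a + d / 2) _) => //; apply/andP; split; lra.
suff ql : p t * df t @[t --> a^'+] --> l.
  have h : (p t)^-1 * (p t * df t) @[t --> a^'+] --> 1^-1 * l.
    by apply: cvgM => //; apply: cvgV => //; exact: oner_neq0.
  rewrite invr1 mul1r in h; apply: cvg_trans h; apply: near_eq_cvg.
  have /cvg_at_right_distP/(_ 1 ltr01)[d1 d10 pd1] := p1.
  near=> t; rewrite mulrA mulVf ?mul1r//.
  suff : 0 < p t by move=> /lt0r_neq0.
  have : `|p t - 1| < 1.
    by apply: pd1; apply/andP; split=> //; near: t; apply: nbhs_right_lt; rewrite ltrDl.
  by rewrite ltr_norml => /andP[+ _]; lra.
apply/cvg_at_right_distP => e e0.
have l1 : 0 < `|l| + 1 by rewrite ltr_wpDl.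
have [|d1 d10 pd1] := (cvg_at_right_distP _ _ _).1 p1 (Num.min 1 (e / 4 / (`|l| + 1))).
  by rewrite lt_min ltr01/= !divr_gt0.
have [|d2 d20 fd2] := is_right_deriveP fl (e := e / 8); first by rewrite divr_gt0.
have B1 : 0 < B + 1 by lra.
exists (Num.min d (Num.min d1 (Num.min d2 (e / 4 / (B + 1))))).
  by rewrite !lt_min d0 d10 d20 !divr_gt0.
move=> r /andP[ar]; rewrite -ltrBlDl !lt_min => /and4P[rd rd1 rd2 rB].
have [||c] := @MVT _ f df a r ar.
- by move=> x; rewrite in_itv/= => /andP[ax _]; exact: fdf.
- apply/continuous_within_itvP => //; split.
  + by move=> x; rewrite in_itv/= => /andP[ax _]; exact: der_continuous (fdf _ ax).
  + exact: is_right_derive_cvg fl.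
  + exact: cvg_at_left_filter (der_continuous (fdf _ ar)).
rewrite in_itv/= => /andP[ac cr] Hc.
have dfc : df c = (f r - f a) / (r - a).
  by rewrite Hc mulfK// subr_eq0 gt_eqF.
have h1 : `|df c - l| < e / 8.
  by rewrite dfc; apply: fd2; rewrite ar -ltrBlDl.
have := pd1 c; rewrite ac -ltrBlDl (lt_trans _ rd1) ?ltrD2r// => /(_ isT).
rewrite lt_min => /andP[pc1 pc2].
have [|x /andP[cx xr] Hq] := @mean_value _ (fun t => p t * df t) dq c r cr.
  by move=> x /andP[cx xr]; apply: qdq; exact: lt_le_trans cx.
have h2 : `|p r * df r - p c * df c| <= e / 4.
  rewrite Hq normrM (gtr0_norm (_ : 0 < r - c)) ?subr_gt0//.
  apply: (@le_trans _ _ ((B + 1) * (r - a))).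
    apply: ler_pM => //; rewrite ?subr_ge0 ?(ltW cr)//.
      apply: (@le_trans _ _ B); last by lra.
      apply: dqB; rewrite (lt_trans ac cx) -ltrBlDl (lt_trans _ rd)// ltrD2r//.
    by rewrite lerD2l lerN2 ltW.
  by rewrite mulrC -ler_pdivlMr// ltW.
have h3 : `|p c * (df c - l)| <= e / 4.
  rewrite normrM; apply: (@le_trans _ _ (2 * (e / 8))); last by lra.
  apply: ler_pM => //; last exact: ltW.
  have := ler_normD (p c - 1) 1; rewrite subrK normr1; lra.
have h4 : `|(p c - 1) * l| < e / 4.
  rewrite normrM; apply: (@le_lt_trans _ _ (`|p c - 1| * (`|l| + 1))).
    by rewrite ler_wpM2l// lerDl.
  by rewrite -ltr_pdivlMr.
(* Oscillation of [p * df] between [c] and [r], error of the slope at [c], error of the weight at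
   [c]: each is at most [e / 4]. *)
have -> : p r * df r - l =
  (p r * df r - p c * df c) + p c * (df c - l) + (p c - 1) * l by ring.
have := ler_normD (p r * df r - p c * df c + p c * (df c - l)) ((p c - 1) * l).
have := ler_normD (p r * df r - p c * df c) (p c * (df c - l)).
lra.
Unshelve. all: by end_near. Qed.

End limits.

(** * Norm bounds through dominating primitives *)

Section integrals.
Variable R : realType.
Implicit Types (f F dF : R -> R) (a b x r s t : R).
Notation mu := (@lebesgue_measure R).

Lemma continuous_itv_integrable f a b :
  (forall r, a <= r -> {for r, continuous f}) ->
  mu.-integrable `[a, b] (EFin \o f).
Proof.
move=> fc; apply: continuous_compact_integrable; first exact: segment_compact.
by apply: continuous_in_subspaceT => x; rewrite inE/= in_itv/= => /andP[/fc].
Qed.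

Lemma is_derive_parameterized_integral f a x : a < x ->
  (forall r, a <= r -> {for r, continuous f}) ->
  is_derive x 1 (parameterized_integral mu a ^~ f) (f x).
Proof.
move=> ax fc; have xx1 : x < x + 1 by rewrite ltrDl.
have [|G1 G2] := continuous_FTC1_closed xx1 (continuous_itv_integrable (x + 1) fc) ax.
  by apply: fc; exact: ltW.
by apply: DeriveDef; [exact: G1|rewrite -derive1E].
Qed.

(** The difference of [F] and the running integral of [f] is nondecreasing and tends to [F s] at
    [s]; integrability of [dF] never enters. *)
Lemma integral_itv_le f F dF a s t : a < s -> s < t ->
  (forall r, a < r -> {for r, continuous f}) ->
  (forall r, a < r -> is_derive r 1 F (dF r)) ->
  (forall r, a < r -> f r <= dF r) ->
  (\int[mu]_(r in `[s, t]) (f r)%:E <= (F t - F s)%:E)%E.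
Proof.
move=> as_ st fc FdF fdF.
have sc r : s <= r -> {for r, continuous f} by move=> sr; apply: fc; exact: lt_le_trans sr.
have fi := continuous_itv_integrable t sc.
pose G := parameterized_integral mu s ^~ f.
have Gs : G x @[x --> s^'+] --> (0 : R).
  apply: cvg_trans (parameterized_integral_cvg_left st fi).
  by apply: cvg_app; exact: cvg_within.
have := @nondecreasing_ge_right _ (fun x => F x - G x) s (F s - 0) _ _ t st.
rewrite subr0 => H.
have {H} : F s <= F t - G t.
  apply: H.
    apply: (@derive_ge0_le _ _ (fun x => dF x - f x)) => x sx.
      apply: derB; first by apply: FdF; exact: lt_trans sx.
      exact: is_derive_parameterized_integral.
    by rewrite subr_ge0 fdF//; exact: lt_trans sx.
  rewrite -[X in _ --> X]subr0; apply: cvgB => //.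
  exact: cvg_at_right_filter (der_continuous (FdF _ as_)).
have -> : (\int[mu]_(r in `[s, t]) (f r)%:E = (G t)%:E)%E.
  by rewrite /G /parameterized_integral /Rintegral fineK//; exact: integrable_fin_num.
by rewrite lee_fin; lra.
Qed.

(** Monotone convergence along the compact intervals [I i], which avoid the endpoint [a], where
    nothing is assumed of [f] or [F]. A bound on the increments of [F] replaces limits at both
    ends. *)
Lemma integral_bndy_le f F dF a (K : R) :
  (forall r, a < r -> {for r, continuous f}) ->
  (forall r, a < r -> 0 <= f r) ->
  (forall r, a < r -> is_derive r 1 F (dF r)) ->
  (forall r, a < r -> f r <= dF r) ->
  (forall s t, a < s -> s <= t -> F t - F s <= K) ->
  (\int[mu]_(r in `]a, +oo[) (f r)%:E <= K%:E)%E.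
Proof.
move=> fc f0 FdF fdF FK.
pose I (i : nat) : set R := `[a + i.+1%:R^-1, a + i.+2%:R]%classic.
have UI : `]a, +oo[%classic = \bigcup_i I i.
  apply/seteqP; split=> [x/=|x [i _]]; rewrite /I/= !in_itv/= ?andbT.
    move=> ax; have xa : 0 < x - a by rewrite subr_gt0.
    (* One index serves both ends: the inverse of [x - a] controls the left one, [x - a] itself the
       right one. *)
    pose m := Num.truncn (Num.max (x - a) (x - a)^-1).
    have mP : Num.max (x - a) (x - a)^-1 < m.+1%:R.
      exact: truncnS_gt.
    move: mP; rewrite gt_max => /andP[m1 m2].
    exists m => //=; rewrite in_itv/= -lerBrDl -[x <= _]lerBlDl; apply/andP; split.
      by rewrite -(invrK (x - a)) lef_pV2 ?posrE ?invr_gt0// ltW.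
    by rewrite ltW// (lt_trans m1)// ltr_nat.
  by move=> /andP[+ _]; apply: lt_le_trans; rewrite ltrDl invr_gt0.
have mf : measurable_fun `]a, +oo[%classic f.
  apply: open_continuous_measurable_fun.
    exact: interval_open.
  by move=> x; rewrite inE/= in_itv/= andbT => /fc.
rewrite UI.
have cI : (\int[mu]_(r in I i) (f r)%:E)%E @[i --> \oo] -->
    (\int[mu]_(r in \bigcup_i I i) (f r)%:E)%E.
  apply: ge0_nondecreasing_set_cvg_integral.
  - apply/nondecreasing_seqP => i; rewrite subsetEset; apply: subset_itv => //.
      by rewrite bnd_simp lerD2l lef_pV2 ?posrE// ler_nat.
    by rewrite bnd_simp lerD2l ler_nat.
  - by move=> i; exact: measurable_itv.
  - move=> i; apply/measurable_EFinP; apply: measurable_funS mf => //.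
    by rewrite UI; exact: bigcup_sup.
  - move=> i x Ix; rewrite lee_fin; apply: f0.
    have : (\bigcup_i I i) x by exists i.
    by rewrite -UI/= in_itv/= andbT.
rewrite -(cvg_lim _ cI)//.
apply: lime_le; first exact: cvgP cI.
apply: nearW => i; apply: le_trans (integral_itv_le (a := a) _ _ fc FdF fdF) _.
- by rewrite ltrDl invr_gt0.
- rewrite ltrD2l (@le_lt_trans _ _ 1)//; last by rewrite ltr1n.
  by rewrite invf_le1// ler1n.
- rewrite lee_fin; apply: FK; first by rewrite ltrDl invr_gt0.
  rewrite lerD2l (@le_trans _ _ 1)//; last by rewrite ler1n.
  by rewrite invf_le1// ler1n.
Qed.

Lemma L2r_norm_le n f F dF (c K : R) : 0 <= c -> K <= c ^+ 2 ->
  (forall r, 1 < r -> {for r, continuous f}) ->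
  (forall r, 1 < r -> is_derive r 1 F (dF r)) ->
  (forall r, 1 < r -> f r ^+ 2 * r ^+ n.-1 <= dF r) ->
  (forall s t, 1 < s -> s <= t -> F t - F s <= K) ->
  (L2r_norm n f <= c%:E)%E.
Proof.
move=> c0 Kc fc FdF fdF FK; rewrite /L2r_norm.
have -> : c%:E = ((c ^+ 2)%:E `^ 2^-1)%E.
  by rewrite poweR_EFin -[_ ^+ 2]powR_mulrn// -powRrM mulfV// powRr1.
apply: gt0_ler_poweR.
- by rewrite invr_ge0.
- rewrite in_itv/= leey andbT; apply: integral_ge0 => x; rewrite /= in_itv/= andbT => x1.
  by rewrite lee_fin mulr_ge0 ?exprn_ge0// ltW// (lt_trans _ x1).
- by rewrite in_itv/= leey andbT lee_fin sqr_ge0.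
have -> : (\int[mu]_(r in `]1%R, +oo[) (`|f r| ^+ 2 * r ^+ n.-1)%:E =
  \int[mu]_(r in `]1%R, +oo[) (f r ^+ 2 * r ^+ n.-1)%:E)%E.
  by apply: eq_integral => x _; rewrite real_normK// num_real.
apply: (@le_trans _ _ K%:E); last by rewrite lee_fin.
apply: (integral_bndy_le (F := F) (dF := dF)) => // r r1.
- apply: cvgM; last exact: exprn_continuous.
  by apply: cvgM; exact: fc.
- by rewrite mulr_ge0 ?sqr_ge0 ?exprn_ge0// ltW// (lt_trans _ r1).
Qed.

Lemma Linfty_norm_le f (K : R) : 0 <= K ->
  (forall r, 1 < r -> `|f r| <= K) -> (Linfty_norm f <= K%:E)%E.
Proof.
move=> K0 fK; rewrite /Linfty_norm unlock /Lnorm.body.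
(* The norm is an essential supremum if the whole space has positive measure, and 0 by convention
   otherwise. *)
case: ifP => _; last by rewrite lee_fin.
apply/ess_supP; exists (~` `]1, +oo[%classic); split.
- exact: measurableC.
- by rewrite -[RHS](measure0 mu) /mrestr; congr (mu _); exact: setICl.
- move=> x /= + x1; apply; rewrite lee_fin; apply: fK.
  by move: x1; rewrite in_itv/= andbT.
Qed.

End integrals.

(** * The enthalpy and its potential *)

Section enthalpy.
Variable R : realType.
Implicit Types (gamma p x y : R) (H : R -> R).

Lemma is_derive_powR (c x : R) : 0 < x ->
  is_derive x 1 (fun y => y `^ c) (c * x `^ (c - 1)).
Proof.
move=> x0; have xI : x \in `]0, +oo[%R by rewrite in_itv/= x0.
apply: DeriveDef; first exact: derivable_powR.
by rewrite -derive1E powR_derive1.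
Qed.

Lemma powRB1 (c x : R) : 0 < x -> x `^ (c - 1) = x `^ c / x.
Proof.
move=> x0; rewrite powRD; last by rewrite (gt_eqF x0) implybT.
by rewrite powR_inv1 ?ltW.
Qed.

Lemma is_derive_pressure gamma x : 0 < x ->
  is_derive x 1 (pressure gamma) (gamma * x `^ gamma / x).
Proof.
by move=> x0; apply: (derE (is_derive_powR gamma x0)); rewrite powRB1// mulrA.
Qed.

(** This form of [P' / rho] is common to both branches of [enthalpy], so that [gamma = 1] needs no
    separate treatment later. *)
Lemma is_derive_enthalpy gamma x : 0 < x ->
  is_derive x 1 (enthalpy gamma) (gamma * x `^ gamma / x ^+ 2).
Proof.
move=> x0; have xn0 : x != 0 by rewrite gt_eqF.
rewrite /enthalpy; have [->|g1] := eqVneq gamma 1.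
  apply: (derE (is_derive1_ln x0)); rewrite powRr1 ?ltW//; field.
  exact: xn0.
apply: (derE (derZ (gamma / (gamma - 1)) (is_derive_powR (gamma - 1) x0))).
rewrite !powRB1//; field.
by rewrite xn0 subr_eq0.
Qed.

Lemma enthalpy_potential_exists gamma p : 0 < p -> exists H : R -> R, H p = 0 /\
  forall x, 0 < x -> is_derive x 1 H (enthalpy gamma x - enthalpy gamma p).
Proof.
move=> p0; rewrite /enthalpy; case: (eqVneq gamma 1) => [_|g1].
  exists (fun x => x * ln x - x - (x - p) * ln p - (p * ln p - p)); split.
    by ring.
  move=> x x0; have := derB (derB (derB (derM (der_id x) (is_derive1_ln x0))
    (der_id x)) (der_affine p (ln p) x)) (der_cst (p * ln p - p) x).
  by move=> /derE; apply; field; rewrite gt_eqF.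
pose c := gamma / (gamma - 1) * p `^ (gamma - 1).
exists (fun x => (gamma - 1)^-1 * x `^ gamma - (x - p) * c -
   (gamma - 1)^-1 * p `^ gamma); split; first by ring.
move=> x x0; have := derB (derB (derZ (gamma - 1)^-1 (is_derive_powR gamma x0))
  (der_affine p c x)) (der_cst ((gamma - 1)^-1 * p `^ gamma) x).
by move=> /derE; apply; rewrite /c; field; rewrite subr_eq0.
Qed.

(** In the derivative [gamma * z ^ gamma / z ^ 2] numerator and denominator are bounded separately
    at opposite ends of [[a, b]], whatever the sign of [gamma - 2]. *)
Lemma enthalpy_bilipschitz gamma (a b : R) : 1 <= gamma -> 0 < a -> a <= b ->
  exists m M : R, [/\ 0 < m, 0 < M & forall x y, a <= x -> x <= y -> y <= b ->
    m * (y - x) <= enthalpy gamma y - enthalpy gamma x <= M * (y - x)].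
Proof.
move=> g1 a0 ab; have b0 : 0 < b by exact: lt_le_trans ab.
have g0 : 0 < gamma by exact: lt_le_trans g1.
exists (gamma * a `^ gamma / b ^+ 2), (gamma * b `^ gamma / a ^+ 2); split.
- by rewrite divr_gt0 ?mulr_gt0 ?powR_gt0 ?exprn_gt0.
- by rewrite divr_gt0 ?mulr_gt0 ?powR_gt0 ?exprn_gt0.
move=> x y ax; rewrite le_eqVlt => /predU1P[->|xy yb].
  by rewrite !subrr !mulr0 lexx.
have [z /andP[xz _]|z /andP[xz zy] ->] := @mean_value _ (enthalpy gamma)
  (fun z => gamma * z `^ gamma / z ^+ 2) _ _ xy.
  by apply: is_derive_enthalpy; exact: lt_le_trans (lt_le_trans a0 ax) xz.
have az : a <= z by exact: le_trans (ltW xz).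
have zb : z <= b by exact: le_trans (ltW zy) yb.
have z0 : 0 < z by exact: lt_le_trans az.
have yx0 : 0 <= y - x by rewrite subr_ge0 ltW.
apply/andP; split; apply: ler_wpM2r => //; apply: ler_pM => //.
- by rewrite mulr_ge0 ?powR_ge0 ?ltW.
- by rewrite invr_ge0 exprn_ge0// ltW.
- by rewrite ler_pM2l// ge0_ler_powR// ?nnegrE ltW.
- by rewrite lef_pV2 ?posrE ?exprn_gt0// lerXn2r ?nnegrE// ltW.
- by rewrite mulr_ge0 ?powR_ge0 ?ltW.
- by rewrite invr_ge0 exprn_ge0// ltW.
- by rewrite ler_pM2l// ge0_ler_powR// ?nnegrE ltW.
- by rewrite lef_pV2 ?posrE ?exprn_gt0// lerXn2r ?nnegrE// ltW.
Qed.

Lemma enthalpy_le gamma x y : 1 <= gamma -> 0 < x -> x <= y ->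
  enthalpy gamma x <= enthalpy gamma y.
Proof.
move=> g1 x0 xy; have [m [M [m0 _ /(_ x y)]]] := enthalpy_bilipschitz g1 x0 xy.
rewrite !lexx xy => /(_ isT isT isT)/andP[+ _].
have : 0 <= m * (y - x) by rewrite mulr_ge0 ?subr_ge0// ltW.
lra.
Qed.

Lemma enthalpy_monotone gamma x y : 1 <= gamma -> 0 < x -> 0 < y ->
  0 <= (enthalpy gamma x - enthalpy gamma y) * (x - y).
Proof.
move=> g1 x0 y0; have [xy|/ltW yx] := leP x y.
  by have := enthalpy_le g1 x0 xy; nra.
by have := enthalpy_le g1 y0 yx; nra.
Qed.

(** The enthalpy may grow slower than linearly, as the logarithm does, so it is not strongly
    monotone on the whole half-line. The factor [1 + |x - p|] makes up for this at large [x]. *)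
Lemma enthalpy_coercive gamma p : 1 <= gamma -> 0 < p ->
  exists2 c : R, 0 < c & forall x, 0 < x -> c * (x - p) ^+ 2 <=
    (enthalpy gamma x - enthalpy gamma p) * (x - p) * (1 + `|x - p|).
Proof.
move=> g1 p0; have p20 : 0 < p / 2 by lra.
have [|m [M [m0 _ mM]]] := enthalpy_bilipschitz g1 p20 (_ : p / 2 <= 2 * p).
  by lra.
have {}mM x y : p / 2 <= x -> x <= y -> y <= 2 * p ->
    m * (y - x) <= enthalpy gamma y - enthalpy gamma x.
  by move=> px xy yp; case/andP: (mM x y px xy yp).
(* [m / 2] serves [x <= 2 * p]: below [p / 2] the enthalpy gap is at least [m * p / 2], while
   [p - x <= p]. Beyond [2 * p] the gap is at least [m * p]. *)
exists (Num.min (m / 2) (m * p)); first by rewrite lt_min divr_gt0 ?mulr_gt0.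
move=> x x0; set c := Num.min _ _.
have c1 : c <= m / 2 by rewrite ge_min lexx.
have c2 : c <= m * p by rewrite ge_min lexx orbT.
have [xp|px] := leP x p.
  rewrite ler0_norm ?subr_le0//.
  suff H : m / 2 * (p - x) <= enthalpy gamma p - enthalpy gamma x.
    apply: (@le_trans _ _ ((enthalpy gamma x - enthalpy gamma p) * (x - p))).
      have : c * (p - x) <= m / 2 * (p - x) by rewrite ler_wpM2r ?subr_ge0.
      nra.
    by rewrite ler_peMr ?enthalpy_monotone// lerDl; lra.
  have [xp2|px2] := leP x (p / 2).
    have h1 := enthalpy_le g1 x0 xp2.
    have h2 : m * (p - p / 2) <= enthalpy gamma p - enthalpy gamma (p / 2).
      by apply: mM => //; lra.
    have : 0 <= m * x by exact: mulr_ge0 (ltW m0) (ltW x0).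
    lra.
  have h2 : m * (p - x) <= enthalpy gamma p - enthalpy gamma x.
    by apply: mM => //; lra.
  have : 0 <= m * (p - x) by rewrite mulr_ge0 ?subr_ge0// ltW.
  lra.
rewrite gtr0_norm ?subr_gt0//.
have xp0 : 0 < x - p by rewrite subr_gt0.
rewrite expr2 mulrA [leRHS]mulrAC ler_pM2r//.
have [x2|x2] := leP x (2 * p).
  have h2 : m * (x - p) <= enthalpy gamma x - enthalpy gamma p.
    by apply: mM => //; lra.
  have h0 : 0 <= m * (x - p) by exact: mulr_ge0 (ltW m0) (ltW xp0).
  have := enthalpy_monotone g1 x0 p0.
  have : c * (x - p) <= m / 2 * (x - p) by rewrite ler_pM2r.
  lra.
have h2 : m * (2 * p - p) <= enthalpy gamma (2 * p) - enthalpy gamma p.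
  by apply: mM => //; lra.
have h3 : enthalpy gamma (2 * p) <= enthalpy gamma x by apply: enthalpy_le => //; lra.
have mp0 : 0 < m * p by rewrite mulr_gt0.
have : c * (x - p) <= m * p * (x - p) by rewrite ler_pM2r.
have : m * p * (x - p) <= (enthalpy gamma x - enthalpy gamma p) * (x - p).
  by rewrite ler_pM2r//; lra.
lra.
Qed.

Section potential.
Variables (gamma p : R) (H : R -> R).
Hypotheses (g1 : 1 <= gamma) (p0 : 0 < p) (Hp : H p = 0).
Hypothesis dH :
  forall x, 0 < x -> is_derive x 1 H (enthalpy gamma x - enthalpy gamma p).

(** Tangent-line inequality: the slope at the mean value point is compared with the slope at [y] by
    monotonicity of the enthalpy. *)
Lemma potential_convex x y : 0 < x -> 0 < y ->
  (enthalpy gamma y - enthalpy gamma p) * (x - y) <= H x - H y.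
Proof.
move=> x0 y0; have [xy|yx|->] := ltgtP x y; last by rewrite !subrr mulr0.
  have [z /andP[xz _]|z /andP[xz zy] Hz] := @mean_value _ H
    (fun z => enthalpy gamma z - enthalpy gamma p) _ _ xy.
    by apply: dH; exact: lt_le_trans xz.
  have := enthalpy_le g1 (lt_trans x0 xz) (ltW zy).
  nra.
have [z /andP[yz _]|z /andP[yz zx] ->] := @mean_value _ H
    (fun z => enthalpy gamma z - enthalpy gamma p) _ _ yx.
  by apply: dH; exact: lt_le_trans yz.
have := enthalpy_le g1 y0 (ltW yz); nra.
Qed.

Lemma potential_ge0 x : 0 < x -> 0 <= H x.
Proof. by move=> x0; have := potential_convex x0 p0; rewrite Hp; lra. Qed.

Lemma potential_le x : 0 < x ->
  H x <= (enthalpy gamma x - enthalpy gamma p) * (x - p).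
Proof. by move=> x0; have := potential_convex p0 x0; rewrite Hp; lra. Qed.

(* Convexity at the midpoint of [x] and [p] reduces this to the coercivity of
   the enthalpy there. *)
Lemma potential_coercive (c x : R) :
  (forall y, 0 < y -> c * (y - p) ^+ 2 <=
    (enthalpy gamma y - enthalpy gamma p) * (y - p) * (1 + `|y - p|)) ->
  0 < x -> c / 4 * (x - p) ^+ 2 <= H x * (1 + `|x - p|).
Proof.
move=> hc x0; pose y := (x + p) / 2; have y0 : 0 < y by rewrite divr_gt0 ?addr_gt0.
have yp : y - p = (x - p) / 2 by rewrite /y; lra.
have h1 := hc _ y0; have h2 := potential_ge0 y0; have h3 := potential_convex x0 y0.
have xy : x - y = (x - p) / 2 by rewrite /y; lra.
rewrite xy -yp in h3.
have h4 := enthalpy_monotone g1 y0 p0.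
have h5 : `|y - p| <= `|x - p|.
  by rewrite yp normrM (ger0_norm (_ : 0 <= 2^-1)) ?invr_ge0//; have := normr_ge0 (x - p); lra.
apply: (@le_trans _ _ (c * (y - p) ^+ 2)); first by rewrite yp; lra.
apply: le_trans h1 _; apply: ler_pM => //.
- lra.
- by rewrite lerD2l.
Qed.

End potential.
End enthalpy.

(** * The stationary equation *)

Section radial.
Variable R : realType.
Implicit Types (r s t : R) (k : nat).

Lemma derivable_is_derive1 (f : R -> R) (x : R) :
  derivable f x 1 -> is_derive x 1 f ((f^`())%classic x).
Proof. by move=> fx; apply: DeriveDef => //; rewrite derive1E. Qed.

Lemma der_pow k r : r != 0 ->
  is_derive r 1 (fun x : R => x ^+ k) (k%:R / r * r ^+ k).
Proof.
move=> r0; case: k => [|k].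
  by apply: (derE (der_cst 1 r)); rewrite !mul0r.
apply: (derE (derX k (der_id r))); rewrite exprS; field.
exact: r0.
Qed.

Lemma der_flux (u1 : R -> R) k r (a : R) : r != 0 -> is_derive r 1 u1 a ->
  is_derive r 1 (fun x => x ^+ k * u1 x) (r ^+ k * (a + k%:R / r * u1 r)).
Proof.
move=> r0 u1a; apply: (derE (derM (der_pow k r0) u1a)); ring.
Qed.

(* The flux [r ^ k u'] would grow like [r ^ (k + 1)], so [u] like [r ^ 2]. *)
Lemma laplacian_ge_diverges (u u1 u2 : R -> R) k (l A p : R) : 0 < l -> 1 <= A ->
  (forall r, 1 < r -> is_derive r 1 u (u1 r)) ->
  (forall r, 1 < r -> is_derive r 1 u1 (u2 r)) ->
  (forall r, A < r -> l <= u2 r + k%:R / r * u1 r) ->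
  ~ (u r @[r --> +oo] --> p).
Proof.
move=> l0 A1 du du1 lu /cvg_pinfty_distP/(_ 1 ltr01)[B uB].
(* With this [c] the function [c * r ^ (k + 1)] has derivative [l * r ^ k], a lower bound for the
   derivative of the flux. *)
pose c := l / k.+1%:R; have c0 : 0 < c by rewrite divr_gt0.
pose q r := r ^+ k * u1 r - c * r ^+ k.+1.
have qle : forall s t, A < s -> s <= t -> q s <= q t.
  apply: (@derive_ge0_le _ q (fun r => r ^+ k * (u2 r + k%:R / r * u1 r)
      - c * (k.+1%:R * r ^+ k * 1))) => r Ar.
    have r1 : 1 < r by exact: le_lt_trans Ar.
    apply: derB; first by apply: der_flux; [rewrite gt_eqF// (lt_trans _ r1)|exact: du1].
    by apply: derZ; apply: derX; exact: der_id.
  have r0 : 0 <= r ^+ k by rewrite exprn_ge0// ltW// (le_lt_trans _ Ar)// (le_trans _ A1).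
  have -> : c * (k.+1%:R * r ^+ k * 1) = l * r ^+ k.
    by rewrite /c mulr1 mulrA divfK// pnatr_eq0.
  by have := ler_wpM2r r0 (lu _ Ar); lra.
pose s := A + 1; pose K := `|q s|.
have As : A < s by rewrite ltrDl.
have u1ge r : s < r -> c * r - K <= u1 r.
  move=> sr; have r1 : 1 < r by rewrite (lt_trans _ sr)// /s; lra.
  have rk1 : 1 <= r ^+ k by rewrite exprn_ege1// ltW.
  have := qle s r As (ltW sr); have : - K <= q s by rewrite lerNl ler_normr lexx orbT.
  have qr : q r = r ^+ k * u1 r - c * (r * r ^+ k) by rewrite /q exprS.
  rewrite qr => h1 h2.
  rewrite -(ler_pM2l (lt_le_trans ltr01 rk1)).
  have : K <= r ^+ k * K by rewrite ler_peMl ?normr_ge0.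
  lra.
pose q2 r := u r - (c / 2 * r ^+ 2 - K * r).
have q2le : forall s' t, s < s' -> s' <= t -> q2 s' <= q2 t.
  apply: (@derive_ge0_le _ q2 (fun r => u1 r - (c / 2 * (2%:R * r ^+ 1 * 1) - K * 1))) => r sr.
    have r1 : 1 < r by rewrite (lt_trans _ sr)// /s; lra.
    exact: (derB (du _ r1) (derB (derZ (c / 2) (derX 1 (der_id r)))
      (derZ K (der_id r)))).
  by have := u1ge _ sr; rewrite expr1; lra.
pose s1 := s + 1; pose M : R := `|q2 s1| + `|p| + 1.
have M0 : 0 < M by rewrite ltr_wpDl// addr_ge0.
(* Here [c / 2 * r ^ 2 - K * r] exceeds [M], which forces [u r] above [|p| + 1], while [r > B] keeps
   it within 1 of [p]. *)
pose r := Num.max (s1 + 1) (Num.max (B + 1) (2 * (K + M) / c + 1)).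
have rs : s1 + 1 <= r by rewrite le_max lexx.
have rB : B < r by rewrite /r !lt_max ltrDl ltr01 orbT.
have rc : 2 * (K + M) / c < r by rewrite /r !lt_max [X in _ || X]orbC ltrDl ltr01 !orbT.
have r1 : 1 < r by rewrite (lt_le_trans _ rs)// /s1 /s; lra.
have h1 := q2le s1 r (ltac:(by rewrite ltrDl)) (ltac:(by rewrite (le_trans _ rs)// lerDl)).
have h2 : - `|q2 s1| <= q2 s1 by rewrite lerNl ler_normr lexx orbT.
have q2r : q2 r = u r - (c / 2 * r ^+ 2 - K * r) by [].
rewrite q2r in h1.
have := uB _ rB; rewrite ltr_norml => /andP[_ h3].
have h4 := ler_norm p.
have h5 : 2 * (K + M) < c * r by rewrite [ltRHS]mulrC -ltr_pdivrMr.
have h6 : 2 * (K + M) * r < c * r * r by rewrite ltr_pM2r// (lt_trans _ r1).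
have h7 : M < M * r by rewrite ltr_pMr.
move: h1 h6 h7; rewrite /M expr2; lra.
Qed.

End radial.

(** * First integral and wall derivative of a stationary solution *)

Section stationary.
Variables (R : realType) (n : nat) (gamma p kappa b : R) (rho : R -> R).
Hypotheses (g1 : 1 <= gamma) (p0 : 0 < p) (kappa0 : 0 < kappa).
Hypothesis sol : stationary_solution n gamma p kappa b rho.
Implicit Types r s t : R.
Notation k := n.-1.
Let drho := (rho^`())%classic.
Let ddrho := (rho^`(2))%classic.

Lemma stationary_gt0 r : 1 <= r -> 0 < rho r.
Proof. by case: sol => h _ _ _ _; exact: h. Qed.

Lemma stationary_cvg : rho r @[r --> +oo] --> p.
Proof. by case: sol. Qed.

Lemma stationary_derive r : 1 < r -> is_derive r 1 rho (drho r).
Proof.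
by case: sol => _ /(_ r) h _ _ _ /h [h1 _ _]; exact: derivable_is_derive1.
Qed.

Lemma stationary_derive2 r : 1 < r -> is_derive r 1 drho (ddrho r).
Proof.
by case: sol => _ /(_ r) h _ _ _ /h [_ h1 _]; exact: derivable_is_derive1.
Qed.

Let f x := enthalpy gamma x - enthalpy gamma p.

(** Dividing the equation by the positive density and using [h' = P' / rho] shows that the
    difference of the two terms has zero derivative. The point 2 is an arbitrary base point inside
    the domain. *)
Lemma stationary_first_integral r : 1 < r ->
  kappa * radial_laplacian n rho r - enthalpy gamma (rho r) =
  kappa * radial_laplacian n rho 2 - enthalpy gamma (rho 2).
Proof.
pose L := radial_laplacian n rho; pose F t := kappa * L t - enthalpy gamma (rho t).
have dF t : 1 < t -> is_derive t 1 F 0.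
  move=> t1; have t0 : 0 < t by exact: lt_trans t1.
  have rt0 := stationary_gt0 (ltW t1).
  have dL : is_derive t 1 L ((L^`())%classic t).
    apply: derivable_is_derive1; case: sol => _ /(_ t t1) [_ _ h3] _ _ _.
    apply: derivableD; first exact: h3.
    apply: derivableM; last by have := stationary_derive2 t1 => ?; exact: ex_derive.
    apply: derivableM; first exact: derivable_cst.
    apply: derivableV; first by rewrite gt_eqF.
    exact: derivable_id.
  have dP := der_comp (is_derive_pressure gamma rt0) (stationary_derive t1).
  have dh := der_comp (is_derive_enthalpy gamma rt0) (stationary_derive t1).
  apply: (derE (derB (derZ kappa dL) dh)).
  case: sol => _ _ /(_ t t1) + _ _; rewrite derive1E derive_val -/L => eqn.
  have : rho t * (kappa * (L^`())%classic t) = gamma * rho t `^ gamma / rho t * drho t.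
    by rewrite eqn; ring.
  move/(congr1 (fun x => x / rho t)); rewrite mulrAC mulfV ?mul1r ?gt_eqF// => ->.
  by rewrite expr2; field; rewrite gt_eqF.
move=> r1; apply/eqP; rewrite eq_le.
have := @derive_ge0_le _ F (fun=> 0) 1 dF (fun _ _ => lexx 0).
have := @derive_le0_ge _ F (fun=> 0) 1 dF (fun _ _ => lexx 0) => h1 h2.
have [r2|/ltW r2] := leP r 2; apply/andP; split.
- exact: h2.
- exact: h1.
- by apply: h1 => //; lra.
- by apply: h2 => //; lra.
Qed.

(** Since [f (rho r)] tends to 0, a nonzero integration constant [c] would keep the Laplacian of
    [rho], or of its opposite when [c < 0], above a positive constant far out, contradicting
    convergence to [p]. *)
Lemma stationary_ode r : 1 < r -> kappa * radial_laplacian n rho r = f (rho r).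
Proof.
move=> r1; apply/eqP; rewrite /f -subr_eq0.
pose c := kappa * radial_laplacian n rho 2 - enthalpy gamma (rho 2) + enthalpy gamma p.
have Lc t : 1 < t -> kappa * radial_laplacian n rho t = f (rho t) + c.
  by move=> /stationary_first_integral h; rewrite /c -h /f; ring.
have -> : kappa * radial_laplacian n rho r - (enthalpy gamma (rho r) - enthalpy gamma p) = c.
  by rewrite Lc// /f; ring.
have fcvg : f (rho t) @[t --> +oo] --> (0 : R).
  rewrite -(subrr (enthalpy gamma p)); apply: cvgB; last exact: cvg_cst.
  apply: continuous_cvg stationary_cvg.
  exact: der_continuous (is_derive_enthalpy gamma p0).
have [c0|c0|/eqP] := ltgtP 0 c; last by rewrite eq_sym.
- exfalso.
  have [|A fA] := (cvg_pinfty_distP _ _).1 fcvg (c / 2); first by rewrite divr_gt0.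
  have := @laplacian_ge_diverges _ rho drho ddrho k (c / 2 / kappa) (Num.max 1 A) p.
  apply.
  + by rewrite !divr_gt0.
  + by rewrite le_max lexx.
  + exact: stationary_derive.
  + exact: stationary_derive2.
  + move=> t; rewrite gt_max => /andP[t1 /fA]; rewrite subr0 ltr_norml => /andP[h _].
    rewrite ler_pdivrMr// [leRHS]mulrC.
    have := Lc _ t1; rewrite /radial_laplacian -/drho -/ddrho => ->; lra.
  + exact: stationary_cvg.
- exfalso.
  have [|A fA] := (cvg_pinfty_distP _ _).1 fcvg (- c / 2).
    by rewrite divr_gt0// oppr_gt0.
  have := @laplacian_ge_diverges _ (fun t => - rho t) (fun t => - drho t)
     (fun t => - ddrho t) k (- c / 2 / kappa) (Num.max 1 A) (- p).
  apply.
  + by rewrite !divr_gt0// oppr_gt0.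
  + by rewrite le_max lexx.
  + by move=> t /stationary_derive ?; exact: is_deriveN.
  + by move=> t /stationary_derive2 ?; exact: is_deriveN.
  + move=> t; rewrite gt_max => /andP[t1 /fA]; rewrite subr0 ltr_norml => /andP[_ h].
    rewrite ler_pdivrMr// [leRHS]mulrC.
    have := Lc _ t1; rewrite /radial_laplacian -/drho -/ddrho; lra.
  + by apply: cvgN; exact: stationary_cvg.
Qed.

Lemma stationary_flux_derive r : 1 < r ->
  is_derive r 1 (fun t => t ^+ k * drho t) (r ^+ k * (f (rho r) / kappa)).
Proof.
move=> r1; have r0 : 0 < r by exact: lt_trans r1.
apply: (derE (der_flux k _ (stationary_derive2 r1))); first by rewrite gt_eqF.
by rewrite -stationary_ode// [kappa * _]mulrC mulfK ?gt_eqF.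
Qed.

(** The first integral bounds the derivative of the flux near the wall, so the one-sided boundary
    condition becomes a limit of [drho]. *)
Lemma stationary_derivative_cvg : drho r @[r --> 1^'+] --> b.
Proof.
case: (sol) => pos _ _ rd _; have rc := is_right_derive_cvg rd.
set r0 := rho 1; have r00 : 0 < r0 by apply: pos.
(* Near the wall [rho] lies between [r0 / 2] and [2 * r0], where the enthalpy is bounded; keeping
   [r < 2] bounds the weight by [2 ^ k]. *)
have [|d d0 hd] := (cvg_at_right_distP _ _ _).1 rc (r0 / 2); first by rewrite divr_gt0.
pose C : R := `|enthalpy gamma (r0 / 2)| + `|enthalpy gamma (2 * r0)| + `|enthalpy gamma p|.
apply: (@right_derivative_cvg _ rho drho (fun r => r ^+ k)
   (fun r => r ^+ k * (f (rho r) / kappa)) 1 b (Num.min d 1) (2 ^+ k * (C / kappa))) => //.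
- by rewrite lt_min d0 ltr01.
- exact: stationary_derive.
- rewrite -[X in _ --> X](expr1n _ k).
  by apply: cvg_at_right_filter; exact: exprn_continuous.
- exact: stationary_flux_derive.
move=> r /andP[r1]; rewrite -ltrBlDl lt_min => /andP[rd1 rd2].
have := hd r; rewrite r1 -ltrBlDl rd1 => /(_ isT); rewrite ltr_norml => /andP[h1 h2].
rewrite -/r0 in h1 h2.
have p1 : enthalpy gamma (r0 / 2) <= enthalpy gamma (rho r).
  by apply: enthalpy_le => //; lra.
have p2 : enthalpy gamma (rho r) <= enthalpy gamma (2 * r0).
  by apply: enthalpy_le => //; lra.
rewrite !normrM normfV (gtr0_norm kappa0) normrX.
apply: ler_pM => //.
- exact: divr_ge0 (normr_ge0 _) (ltW kappa0).
- by rewrite lerXn2r ?nnegrE// gtr0_norm ?(lt_trans _ r1)//; lra.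
- rewrite ler_pM2r ?invr_gt0//; apply: le_trans (ler_normB _ _) _; rewrite lerD2r.
have := ler_norm (enthalpy gamma (2 * r0)).
have := ler_norm (- enthalpy gamma (r0 / 2)); rewrite normrN => h3 h4.
by rewrite ler_norml; apply/andP; split; have := normr_ge0 (enthalpy gamma (2 * r0));
  have := normr_ge0 (enthalpy gamma (r0 / 2)); lra.
Qed.

End stationary.

(** * Monotone quantities: moment, flux and energy *)

Section stationary_estimates.
Variables (R : realType) (n : nat) (gamma p kappa b : R) (rho : R -> R).
Hypotheses (g1 : 1 <= gamma) (p0 : 0 < p) (kappa0 : 0 < kappa).
Hypothesis sol : stationary_solution n gamma p kappa b rho.
Implicit Types r s t : R.
Notation k := n.-1.
Let drho := (rho^`())%classic.
Let ddrho := (rho^`(2))%classic.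
Let f x := enthalpy gamma x - enthalpy gamma p.
Let drhoP r := stationary_derive sol (r := r).
Let ddrhoP r := stationary_derive2 sol (r := r).
Let rho_gt0 r := stationary_gt0 sol (r := r).

Lemma stationary_sqr_cvg : (rho r - p) ^+ 2 @[r --> +oo] --> (0 : R).
Proof.
have h : rho r - p @[r --> +oo] --> (0 : R).
  rewrite -(subrr p); apply: cvgB; last exact: cvg_cst.
  exact: stationary_cvg sol.
by rewrite -[X in _ --> X](mulr0 0) -expr2; exact: cvg_sqr.
Qed.

Let moment r := r ^+ k * drho r * (rho r - p).
Let dmoment r := r ^+ k * (f (rho r) / kappa) * (rho r - p) + r ^+ k * drho r ^+ 2.

Lemma stationary_moment_derive r : 1 < r -> is_derive r 1 moment (dmoment r).
Proof.
move=> r1; have := derM (stationary_flux_derive p0 kappa0 sol r1)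
  (derB (drhoP r1) (der_cst p r)).
by move=> /derE; apply; rewrite /dmoment /f /drho; ring.
Qed.

Lemma stationary_flux_work_ge0 r : 1 < r -> 0 <= f (rho r) / kappa * (rho r - p).
Proof.
move=> r1; rewrite mulrAC divr_ge0 ?(ltW kappa0)//.
by apply: enthalpy_monotone => //; apply: rho_gt0; exact: ltW.
Qed.

Lemma stationary_moment_nondecreasing s t : 1 < s -> s <= t -> moment s <= moment t.
Proof.
apply: (@derive_ge0_le _ _ dmoment) => [r|r r1]; first exact: stationary_moment_derive.
have r0 : 0 <= r ^+ k by rewrite exprn_ge0// ltW// (lt_trans _ r1).
rewrite /dmoment -mulrA; apply: addr_ge0; apply: mulr_ge0 => //.
  exact: stationary_flux_work_ge0.
exact: sqr_ge0.
Qed.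

Lemma der_sqr_dist r : 1 < r ->
  is_derive r 1 (fun t => (rho t - p) ^+ 2) (2 * (drho r * (rho r - p))).
Proof.
move=> r1; have := derX 1 (derB (drhoP r1) (der_cst p r)).
by move=> /derE; apply; rewrite expr1 /drho; ring.
Qed.

(* Otherwise the moment, half the derivative of [(rho - p) ^ 2] up to a positive
   weight, stays positive and keeps [rho] away from its limit [p]. *)
Lemma stationary_moment_le0 r : 1 < r -> drho r * (rho r - p) <= 0.
Proof.
move=> r1; rewrite leNgt; apply/negP => mr.
have rk t : 1 < t -> 0 < t ^+ k by move=> t1; rewrite exprn_gt0// (lt_trans _ t1).
have pos t : r < t -> 0 < drho t * (rho t - p).
  move=> rt; have t1 := lt_trans r1 rt.
  rewrite -(pmulr_rgt0 _ (rk _ t1)) mulrA.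
  apply: lt_le_trans (stationary_moment_nondecreasing r1 (ltW rt)).
  by rewrite /moment -mulrA pmulr_rgt0// rk.
have rr1 : r < r + 1 by rewrite ltrDl.
have : (rho (r + 1) - p) ^+ 2 <= 0.
  apply: (@nondecreasing_le_pinfty _ (fun t => (rho t - p) ^+ 2) r 0) => //.
    have dsq t : r < t -> is_derive t (1 : R) (fun t => (rho t - p) ^+ 2)
        (2 * (drho t * (rho t - p))).
      by move=> rt; apply: der_sqr_dist; exact: lt_trans rt.
    have dsq0 t : r < t -> 0 <= 2 * (drho t * (rho t - p)).
      by move=> rt; rewrite mulr_ge0// ltW// pos.
    exact: (derive_ge0_le dsq dsq0).
  exact: stationary_sqr_cvg.
have := pos _ rr1; have [->|h] := eqVneq (rho (r + 1) - p) 0; first by rewrite mulr0 ltxx.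
by move=> _; rewrite leNgt exprn_even_gt0// h.
Qed.

(** The sign of the moment makes [drho] and [f (rho r)] of opposite signs, so the squared flux is
    nonincreasing; its limit at the wall is [b ^ 2]. *)
Lemma stationary_flux_le r : 1 < r -> r ^+ k * `|drho r| <= `|b|.
Proof.
move=> r1; have r0 t : 1 < t -> 0 <= t ^+ k.
  by move=> t1; rewrite exprn_ge0// ltW// (lt_trans _ t1).
suff : (r ^+ k * drho r) ^+ 2 <= b ^+ 2.
  by rewrite -ler_sqrt ?sqr_ge0// !sqrtr_sqr normrM (ger0_norm (r0 _ r1)).
apply: (@nonincreasing_le_right _ (fun t => (t ^+ k * drho t) ^+ 2) 1) => //.
  apply: (@derive_le0_ge _ _ (fun t => 2 * (t ^+ k * drho t) ^+ 1 *
     (t ^+ k * (f (rho t) / kappa)))) => t t1.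
    by apply: derX; exact: (stationary_flux_derive p0 kappa0 sol t1).
  have h1 := stationary_moment_le0 t1; have h2 := stationary_flux_work_ge0 t1.
  suff h : drho t * (f (rho t) / kappa) <= 0.
    rewrite expr1 (_ : _ * _ = 2 * (t ^+ k) ^+ 2 * (drho t * (f (rho t) / kappa))); last by ring.
    by rewrite mulr_ge0_le0// mulr_ge0// sqr_ge0.
  (* The sign is read off after multiplying by [(rho t - p) ^ 2], which splits the product into the
     moment and the work term; where this square vanishes, so does [f]. *)
  have [e|h] := eqVneq (rho t - p) 0.
    move/eqP: e; rewrite subr_eq0 => /eqP e.
    by rewrite /f e subrr mul0r mulr0.
  have u0 : 0 < (rho t - p) ^+ 2 by rewrite exprn_even_gt0.
  rewrite -(pmulr_lle0 _ u0).
  have -> : drho t * (f (rho t) / kappa) * (rho t - p) ^+ 2 =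
    drho t * (rho t - p) * (f (rho t) / kappa * (rho t - p)) by ring.
  exact: mulr_le0_ge0.
have h : t ^+ k * drho t @[t --> 1^'+] --> b.
  rewrite -[X in _ --> X]mul1r; apply: cvgM.
    rewrite -[X in _ --> X](expr1n _ k).
    by apply: cvg_at_right_filter; exact: exprn_continuous.
  exact: (stationary_derivative_cvg g1 p0 kappa0 sol).
exact: cvg_sqr.
Qed.

Lemma stationary_slope_le r : 1 < r -> `|drho r| <= `|b|.
Proof.
move=> r1; apply: le_trans (stationary_flux_le r1).
by rewrite ler_peMl// exprn_ege1// ltW.
Qed.

Section energy.
Variable H : R -> R.
Hypothesis Hp : H p = 0.
Hypothesis dH :
  forall x : R, 0 < x -> is_derive x 1 H (enthalpy gamma x - enthalpy gamma p).

(** Curvature dissipates the energy [E]: its derivative is [- (n - 1) / r * kappa * drho ^ 2]. Far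
    out [E] is at least [- H (rho t)], which tends to 0, so no decay of [drho] is required. *)
Lemma stationary_energy r : 1 < r -> H (rho r) <= kappa / 2 * drho r ^+ 2.
Proof.
move=> r1; rewrite -subr_ge0.
pose E t := kappa / 2 * drho t ^+ 2 - H (rho t).
pose G t := - H (rho t).
have Hcvg : G t @[t --> +oo] --> (0 : R).
  rewrite -oppr0; apply: cvgN; rewrite -Hp; apply: continuous_cvg (stationary_cvg sol).
  exact: der_continuous (dH p0).
apply/ler_addgt0Pr => e /((cvg_pinfty_distP _ _).1 Hcvg)[A hA].
pose t := Num.max r (A + 1).
have rt : r <= t by rewrite le_max lexx.
have /hA : A < t by rewrite /t lt_max ltrDl ltr01 orbT.
rewrite subr0 ltr_norml => /andP[h1 _].
suff : E t <= E r.
  rewrite /E -/(G t); have : 0 <= kappa / 2 * drho t ^+ 2.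
    by rewrite mulr_ge0 ?sqr_ge0// divr_ge0// ltW.
  lra.
have dE (x : R) : 1 < x -> is_derive x (1 : R) E (- (k%:R / x * kappa * drho x ^+ 2)).
  move=> x1; have := derB (derZ (kappa / 2) (derX 1 (ddrhoP x1)))
    (der_comp (dH (rho_gt0 (ltW x1))) (drhoP x1)).
  move=> /derE; apply.
  have := stationary_ode p0 kappa0 sol x1; rewrite -/(f _) /radial_laplacian => <-.
  by rewrite expr1 /drho; field; rewrite gt_eqF// (lt_trans _ x1).
have dE0 (x : R) : 1 < x -> - (k%:R / x * kappa * drho x ^+ 2) <= 0.
  move=> x1; rewrite oppr_le0 mulr_ge0 ?sqr_ge0// mulr_ge0 ?(ltW kappa0)//.
  by rewrite divr_ge0// ltW// (lt_trans _ x1).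
exact: (derive_le0_ge dE dE0 r1 rt).
Qed.

End energy.
End stationary_estimates.

(** * Fixed boundary slope *)

Section fixed_slope.
Variable R : realType.
Implicit Types (gamma p a b r s t : R).

Lemma quadratic_bound (c D u : R) : 0 < c -> 0 <= D -> 0 <= u ->
  c / 4 * u ^+ 2 <= D * (1 + u) -> u <= 1 + 8 * D / c.
Proof.
move=> c0 D0 u0 cu; have [u1|u1] := leP u 1.
  by rewrite (le_trans u1)// lerDl divr_ge0 ?mulr_ge0// ltW.
suff : u <= 8 * D / c by lra.
rewrite ler_pdivlMr//; nra.
Qed.

(** The capillarity is [a ^ 4]. The amplitude [M] is of order [a ^ 2] for small [a] and of order [a]
    for large [a]; the product [M * (1 + M)], which is what coercivity produces in the [L^2]
    estimate, is of order [a ^ 2] in both regimes. *)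
Lemma stationary_amplitude n gamma p b : (2 <= n)%N -> 1 <= gamma -> 0 < p ->
  exists2 C : R, 0 <= C & forall a rho, 0 < a ->
    stationary_solution n gamma p (a ^+ 4) b rho ->
    exists M : R, [/\ 0 <= M, forall r, 1 < r -> `|rho r - p| <= M &
      M * (1 + M) <= C * a ^+ 2].
Proof.
move=> n2 g1 p0; have k1 : (0 < n.-1)%N by case: n n2 => [|[]].
have [c c0 hc] := enthalpy_coercive g1 p0.
have [H [Hp dH]] := enthalpy_potential_exists gamma p0.
have b20 : 0 <= b ^+ 2 by rewrite sqr_ge0.
(* Amplitude bound from [quadratic_bound], valid wherever [kappa * drho ^ 2 <= b ^ 2]. *)
pose U : R := 1 + 8 * (b ^+ 2 / 2) / c.
have U1 : 1 <= U by rewrite lerDl divr_ge0 ?(ltW c0)// mulr_ge0// divr_ge0.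
(* The fraction bounds [(rho - p) ^ 2 / kappa] once the factor [1 + |rho - p|] is replaced by
   [1 + U]; the added 1 gives [C1 <= C1 ^ 2] and avoids a square root. *)
pose C1 : R := 1 + 2 * b ^+ 2 * (1 + U) / c.
have C11 : 1 <= C1.
  by rewrite lerDl divr_ge0 ?(ltW c0)//; apply: mulr_ge0; [rewrite mulr_ge0|lra].
pose B : R := `|b|; have B0 : 0 <= B by exact: normr_ge0.
have BB : b ^+ 2 = B ^+ 2 by rewrite real_normK// num_real.
exists (C1 * (1 + C1) + (U + 2 * B) * (1 + (U + 2 * B))).
  by apply: addr_ge0; apply: mulr_ge0; lra.
move=> a rho a0 sol; have k0 : 0 < a ^+ 4 by rewrite exprn_gt0.
have energy r : 1 < r -> c / 4 * `|rho r - p| ^+ 2 <=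
    a ^+ 4 / 2 * ((rho^`())%classic r) ^+ 2 * (1 + `|rho r - p|).
  move=> r1; rewrite real_normK ?num_real//.
  have rr0 := stationary_gt0 sol (ltW r1).
  apply: (le_trans (potential_coercive g1 p0 Hp dH hc rr0)).
  rewrite ler_wpM2r ?addr_ge0//.
  exact: (stationary_energy p0 k0 sol Hp dH r1).
have bound r : 1 < r -> a ^+ 4 * ((rho^`())%classic r) ^+ 2 <= b ^+ 2 ->
    `|rho r - p| <= U.
  move=> r1 h; apply: quadratic_bound => //; first by rewrite divr_ge0.
  apply: (le_trans (energy r r1)); rewrite ler_wpM2r ?addr_ge0//; lra.
have slope r : 1 < r -> `|(rho^`())%classic r| <= B by exact: (stationary_slope_le g1 p0 k0 sol).
have slope2 r : 1 < r -> ((rho^`())%classic r) ^+ 2 <= b ^+ 2.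
  by move=> r1; rewrite BB -(real_normK (num_real _)) lerXn2r ?nnegrE ?slope.
have [a1|a1] := leP a 1.
  have a41 : a ^+ 4 <= 1 by rewrite exprn_ile1// ltW.
  have a20 : 0 <= a ^+ 2 by rewrite sqr_ge0.
  have a21 : a ^+ 2 <= 1 by rewrite exprn_ile1// ltW.
  exists (C1 * a ^+ 2); split.
  - by rewrite mulr_ge0//; lra.
  - move=> r r1; have uU : `|rho r - p| <= U.
      apply: bound => //; apply: le_trans (slope2 _ r1).
      by rewrite ler_piMl ?sqr_ge0.
    have h := energy r r1; have h2 := slope2 _ r1.
    have h3 : a ^+ 4 / 2 * ((rho^`())%classic r) ^+ 2 * (1 + `|rho r - p|) <=
       a ^+ 4 / 2 * b ^+ 2 * (1 + U).
      apply: ler_pM; last by rewrite lerD2l.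
      - by rewrite mulr_ge0 ?sqr_ge0// divr_ge0// ltW.
      - by rewrite addr_ge0.
      - by rewrite ler_wpM2l// divr_ge0// ltW.
    have h4 : `|rho r - p| ^+ 2 <= C1 * (a ^+ 2) ^+ 2.
      have -> : (a ^+ 2) ^+ 2 = a ^+ 4 by rewrite -exprM.
      apply: (@le_trans _ _ (2 * b ^+ 2 * (1 + U) / c * a ^+ 4)).
        rewrite [leRHS]mulrAC ler_pdivlMr//; lra.
      by rewrite ler_wpM2r ?(ltW k0)// /C1; lra.
    have Ca : 0 <= C1 * a ^+ 2 by rewrite mulr_ge0//; lra.
    have : `|rho r - p| ^+ 2 <= (C1 * a ^+ 2) ^+ 2.
      apply: (le_trans h4).
      have -> : (C1 * a ^+ 2) ^+ 2 = C1 ^+ 2 * (a ^+ 2) ^+ 2 by ring.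
      apply: ler_wpM2r; first exact: sqr_ge0.
      by rewrite expr2 ler_peMl//; lra.
    by rewrite ler_pXn2r ?nnegrE.
  - have : C1 * a ^+ 2 * (1 + C1 * a ^+ 2) <= C1 * a ^+ 2 * (1 + C1).
      apply: ler_wpM2l; first by rewrite mulr_ge0//; lra.
      by rewrite lerD2l ler_piMr//; lra.
    have : 0 <= (U + 2 * B) * (1 + (U + 2 * B)) * a ^+ 2.
      by apply: mulr_ge0 => //; apply: mulr_ge0; lra.
    lra.
(* Large capillarity: for [r >= a ^ 2] the flux bound, with [n - 1 >= 1], gives
   [a ^ 2 * |drho| <= |b|], so [U] applies there. *)
have a21 : 1 < a ^+ 2 by rewrite exprn_egt1.
have far r : a ^+ 2 <= r -> `|rho r - p| <= U.
  move=> ar; have r1 : 1 < r by exact: lt_le_trans ar.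
  apply: bound => //.
  have h := stationary_flux_le g1 p0 k0 sol r1.
  have h2 : a ^+ 2 * `|(rho^`())%classic r| <= B.
    apply: le_trans h; rewrite ler_wpM2r//; apply: (le_trans ar).
    by rewrite -[leLHS]expr1 ler_eXn2l.
  have -> : a ^+ 4 * ((rho^`())%classic r) ^+ 2 = (a ^+ 2 * `|(rho^`())%classic r|) ^+ 2.
    by rewrite -[in LHS](real_normK (num_real _)); ring.
  rewrite BB; apply: lerXn2r h2; rewrite ?nnegrE//.
  by rewrite mulr_ge0 ?sqr_ge0.
exists ((U + 2 * B) * a); split.
- by rewrite mulr_ge0 ?(ltW a0)//; lra.
- move=> r r1; have [ra|/ltW ar] := leP (a ^+ 2) r.
    apply: (le_trans (far _ ra)).
    have : U <= U * a by rewrite ler_peMr//; lra.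
    have : 0 <= B * a by rewrite mulr_ge0 ?(ltW a0).
    lra.
  (* Going inwards, [|drho| <= B / r] is weakened to [B / sqrt r], whose primitive gains at most
     [2 * B * a] up to [r = a ^ 2]. *)
  have dsq (x : R) : 1 < x -> is_derive x 1 (fun x => 2 * B * Num.sqrt x) (B / Num.sqrt x).
    move=> x1; have x0 : 0 < x by exact: lt_trans x1.
    apply: (derE (derZ (2 * B) (is_derive1_sqrt x0))).
    by field; rewrite gt_eqF ?sqrtr_gt0.
  have dx (x : R) : 1 < x -> `|(rho^`())%classic x| <= B / Num.sqrt x.
    move=> x1; have x0 : 0 < x by exact: lt_trans x1.
    rewrite ler_pdivlMr ?sqrtr_gt0//.
    apply: le_trans (stationary_flux_le g1 p0 k0 sol x1).
    rewrite mulrC ler_wpM2r//; apply: (@le_trans _ _ x).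
      rewrite -[leRHS](sqr_sqrtr (ltW x0)) expr2 ler_peMl ?sqrtr_ge0//.
      by rewrite -sqrtr1 ler_sqrt// ltW.
    by rewrite -[leLHS]expr1 ler_eXn2l.
  have dm (x : R) : 1 < x -> is_derive x (1 : R) (fun x => 2 * B * Num.sqrt x - rho x)
      (B / Num.sqrt x - (rho^`())%classic x).
    by move=> x1; exact: (derB (dsq x x1) (stationary_derive sol x1)).
  have dp (x : R) : 1 < x -> is_derive x (1 : R) (fun x => 2 * B * Num.sqrt x + rho x)
      (B / Num.sqrt x + (rho^`())%classic x).
    by move=> x1; exact: (derD (dsq x x1) (stationary_derive sol x1)).
  have dm0 (x : R) : 1 < x -> 0 <= B / Num.sqrt x - (rho^`())%classic x.
    by move=> /dx; rewrite ler_norml => /andP[_]; lra.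
  have dp0 (x : R) : 1 < x -> 0 <= B / Num.sqrt x + (rho^`())%classic x.
    by move=> /dx; rewrite ler_norml => /andP[+ _]; lra.
  have h1 := derive_ge0_le dm dm0 r1 ar; have h2 := derive_ge0_le dp dp0 r1 ar.
  rewrite /= in h1 h2.
  rewrite sqrtr_sqr gtr0_norm// in h1 h2.
  have h3 : 0 <= B * Num.sqrt r by rewrite mulr_ge0 ?sqrtr_ge0.
  have := far _ (lexx _); rewrite ler_norml => /andP[h4 h5].
  have : U <= U * a by rewrite ler_peMr//; lra.
  by move=> h6; rewrite ler_norml; apply/andP; split; lra.
- have UB : 0 <= U + 2 * B by lra.
  have : (U + 2 * B) * a * (1 + (U + 2 * B) * a) <=
      (U + 2 * B) * a * ((1 + (U + 2 * B)) * a).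
    apply: ler_wpM2l; first exact: mulr_ge0 UB (ltW a0).
    lra.
  have : 0 <= C1 * (1 + C1) * a ^+ 2.
    by apply: mulr_ge0; [apply: mulr_ge0; lra|exact: sqr_ge0].
  rewrite !expr2; lra.
Qed.

(** The derivative of the moment is a sum of two nonnegative terms: one dominates the weighted
    square of [drho], the other that of [rho - p] through coercivity. *)
Lemma fixed_slope_estimates n gamma p b : (2 <= n)%N -> 1 <= gamma -> 0 < p ->
  exists2 C : R, 0 < C & forall a rho, 0 < a ->
    stationary_solution n gamma p (a ^+ 4) b rho ->
    [/\ (L2r_norm n (fun r => rho r - p)%R <= (C * a ^+ 3)%:E)%E,
        (L2r_norm n (rho^`())%classic <= (C * a)%:E)%E
      & (Linfty_norm (fun r => rho r - p)%R <= (C * a ^+ 2)%:E)%E].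
Proof.
move=> n2 g1 p0; have [C0 C00 hC] := stationary_amplitude b n2 g1 p0.
have [c c0 hc] := enthalpy_coercive g1 p0.
pose B : R := `|b|; have B0 : 0 <= B by exact: normr_ge0.
have BC : 0 <= B * C0 by rewrite mulr_ge0.
have BCc : 0 <= B * C0 / c by rewrite divr_ge0// ltW.
pose C : R := 1 + B * C0 + B * C0 / c + C0.
exists C; first by rewrite /C; lra.
have CC (x : R) : 0 <= x -> x <= C -> x <= C ^+ 2.
  move=> x0 xC; apply: (le_trans xC); rewrite expr2 ler_peMl// /C; lra.
move=> a rho a0 sol; have k0 : 0 < a ^+ 4 by rewrite exprn_gt0.
have [M [M0 uM MC]] := hC a rho a0 sol.
have MM : M <= M * (1 + M) by rewrite ler_peMr//; lra.
have drhoP r := stationary_derive sol (r := r).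
pose drho := (rho^`())%classic.
pose f x := enthalpy gamma x - enthalpy gamma p.
pose F r := r ^+ n.-1 * drho r * (rho r - p).
pose dF r := r ^+ n.-1 * (f (rho r) / a ^+ 4) * (rho r - p) + r ^+ n.-1 * drho r ^+ 2.
have dFP r : 1 < r -> is_derive r 1 F (dF r).
  exact: (stationary_moment_derive p0 k0 sol).
(* The moment is nonpositive at [t], and at [s] it is at least minus the flux bound times the
   amplitude. *)
have FB s t : 1 < s -> s <= t -> F t - F s <= B * M.
  move=> s1 st; have t1 := lt_le_trans s1 st.
  have : F t <= 0.
    rewrite /F -mulrA mulr_ge0_le0//; first by rewrite exprn_ge0// ltW// (lt_trans _ t1).
    exact: (stationary_moment_le0 g1 p0 k0 sol).
  have : - F s <= B * M.
    apply: (le_trans (ler_norm _)); rewrite normrN /F normrM.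
    apply: ler_pM => //; last exact: uM.
    rewrite normrM ger0_norm; first exact: (stationary_flux_le g1 p0 k0 sol).
    by rewrite exprn_ge0// ltW// (lt_trans _ s1).
  lra.
have rk r : 1 < r -> 0 <= r ^+ n.-1.
  by move=> r1; rewrite exprn_ge0// ltW// (lt_trans _ r1).
have work r : 1 < r -> 0 <= f (rho r) / a ^+ 4 * (rho r - p).
  exact: (stationary_flux_work_ge0 g1 p0 k0 sol).
have BM : B * M <= B * C0 * a ^+ 2.
  by rewrite -mulrA ler_wpM2l//; exact: le_trans MC.
split.
(* Coercivity constant and capillarity combined: [e] times the work term of [dF] dominates
   [r ^ (n - 1) * (rho - p) ^ 2]. *)
- pose e := a ^+ 4 * (1 + M) / c.
  have e0 : 0 <= e by rewrite divr_ge0 ?(ltW c0)// mulr_ge0 ?(ltW k0)//; lra.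
  apply: (@L2r_norm_le _ n _ (fun r => e * F r) (fun r => e * dF r) _ (e * (B * M))).
  + by rewrite mulr_ge0 ?exprn_ge0 ?(ltW a0)// /C; lra.
  + have -> : (C * a ^+ 3) ^+ 2 = C ^+ 2 * (a ^+ 4 * a ^+ 2).
      by ring.
    have -> : e * (B * M) = B / c * (a ^+ 4 * (M * (1 + M))) by rewrite /e; ring.
    apply: (@le_trans _ _ (B * C0 / c * (a ^+ 4 * a ^+ 2))).
      have -> : B * C0 / c * (a ^+ 4 * a ^+ 2) = B / c * (a ^+ 4 * (C0 * a ^+ 2)) by ring.
      by rewrite ler_wpM2l ?ler_wpM2l ?(ltW k0)// divr_ge0// ltW.
    apply: ler_wpM2r; first by rewrite mulr_ge0 ?sqr_ge0 ?(ltW k0).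
    by apply: CC => //; rewrite /C; lra.
  + move=> r r1; exact: der_continuous (derB (drhoP r r1) (der_cst p r)).
  + by move=> r r1; apply: derZ; exact: dFP.
  + move=> r r1; have rr0 := stationary_gt0 sol (ltW r1).
    have h := hc _ rr0; have h0 := enthalpy_monotone g1 rr0 p0.
    have h1 : c * (rho r - p) ^+ 2 <= f (rho r) * (rho r - p) * (1 + M).
      apply: (le_trans h); rewrite ler_wpM2l// lerD2l; exact: uM.
    have h2 : (rho r - p) ^+ 2 * r ^+ n.-1 <=
        f (rho r) * (rho r - p) * (1 + M) / c * r ^+ n.-1.
      by rewrite ler_wpM2r ?rk// ler_pdivlMr// mulrC.
    apply: (le_trans h2).
    have -> : f (rho r) * (rho r - p) * (1 + M) / c * r ^+ n.-1 =
      e * (r ^+ n.-1 * (f (rho r) / a ^+ 4) * (rho r - p)).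
      by rewrite /e; field; rewrite !gt_eqF.
    by rewrite ler_wpM2l// /dF lerDl mulr_ge0 ?rk ?sqr_ge0.
  + by move=> s t s1 st; rewrite -mulrBr ler_wpM2l// FB.
- apply: (@L2r_norm_le _ n _ F dF (C * a) (B * M) _ _ _ dFP).
  + by rewrite mulr_ge0 ?(ltW a0)// /C; lra.
  + have -> : (C * a) ^+ 2 = C ^+ 2 * a ^+ 2 by ring.
    apply: (le_trans BM); apply: ler_wpM2r; first exact: sqr_ge0.
    by apply: CC => //; rewrite /C; lra.
  + by move=> r r1; exact: der_continuous (stationary_derive2 sol r1).
  + move=> r r1; rewrite /dF -/drho mulrC lerDr -mulrA mulr_ge0 ?rk//.
    exact: work.
  + exact: FB.
- apply: Linfty_norm_le.
    by rewrite mulr_ge0 ?sqr_ge0// /C; lra.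
  move=> r r1; apply: (le_trans (uM _ r1)); apply: (le_trans MM); apply: (le_trans MC).
  by rewrite ler_wpM2r ?sqr_ge0// /C; lra.
Qed.

End fixed_slope.

(** * The boundary layer *)

Section autonomous.
Variable R : realType.
Implicit Types (x y z : R).
Notation mu := (@lebesgue_measure R).

(* Separation of variables: the solution is the inverse of an antiderivative of
   [1 / Psi]. *)
Lemma autonomous_solution (Psi : R -> R) (c C x0 : R) : 0 < c ->
  continuous Psi -> (forall x, c <= Psi x <= C) ->
  exists X : R -> R, [/\ X 0 = x0,
    forall y, 0 <= y -> is_derive y 1 X (Psi (X y)) &
    forall y, 0 <= y -> x0 + c * y <= X y].
Proof.
move=> c0 Pc cPC; have P0 x : 0 < Psi x.
  by have /andP[h _] := cPC x; exact: lt_le_trans h.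
have C0 : 0 < C by have /andP[_ h] := cPC 0; exact: lt_le_trans h.
(* Starting the antiderivative to the left of [x0] makes [x0] an interior point, so [X] has a
   two-sided derivative at 0. *)
pose a := x0 - 1; have ax0 : a < x0 by rewrite /a ltrBlDr ltrDl.
pose T := parameterized_integral mu a ^~ (fun s => (Psi s)^-1).
have dT x : a < x -> is_derive x 1 T (Psi x)^-1.
  move=> ax; apply: is_derive_parameterized_integral => // r _.
  by apply: continuousV; [rewrite gt_eqF|exact: Pc].
have Tlt x y : a < x -> x < y -> C^-1 * (y - x) <= T y - T x.
  move=> ax xy; have [z /andP[xz _]|z _ ->] := @mean_value _ T (fun z => (Psi z)^-1) _ _ xy.
    by apply: dT; exact: lt_le_trans xz.
  apply: ler_wpM2r; first by rewrite subr_ge0 ltW.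
  by rewrite lef_pV2 ?posrE//; case/andP: (cPC z).
have Tinj x y : a < x -> a < y -> T x = T y -> x = y.
  move=> ax ay Txy; have C10 : 0 < C^-1 by rewrite invr_gt0.
  have [xy|yx|//] := ltgtP x y.
    have := Tlt _ _ ax xy; have : 0 < C^-1 * (y - x) by rewrite mulr_gt0 ?subr_gt0.
    by rewrite Txy; lra.
  have := Tlt _ _ ay yx; have : 0 < C^-1 * (x - y) by rewrite mulr_gt0 ?subr_gt0.
  by rewrite Txy; lra.
(* The default 0 is never met for [t >= T x0], where [Tg] shows the preimage to be nonempty. *)
pose g t := xget 0 [set x | a < x /\ T x = t].
have gT x : a < x -> g (T x) = x.
  move=> ax; have [h1 h2] : [set x' | a < x' /\ T x' = T x] (g (T x)).
    by apply: xgetPex; exists x.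
  exact: Tinj.
have Tg t : T x0 <= t -> a < g t /\ T (g t) = t.
  move=> tx; have [] : [set x | a < x /\ T x = t] (g t).
    (* [T] grows at rate at least the inverse of [C], so it has passed [t] at [b]. *)
    apply: xgetPex; pose b := x0 + C * (t - T x0) + 1.
    have xb : x0 < b.
      have : 0 <= C * (t - T x0) by rewrite mulr_ge0 ?subr_ge0// ltW.
      by rewrite /b; lra.
    have tb : t <= T b.
      have := Tlt _ _ ax0 xb; rewrite /b.
      have -> : C^-1 * (x0 + C * (t - T x0) + 1 - x0) = t - T x0 + C^-1.
        by field; rewrite gt_eqF.
      have : 0 < C^-1 by rewrite invr_gt0.
      lra.
    have [||z] := @IVT _ T x0 b t (ltW xb).
    - apply: derivable_within_continuous => z; rewrite in_itv/= => /andP[xz _].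
      by have := dT z (lt_le_trans ax0 xz) => ?; exact: ex_derive.
    - by rewrite ge_min le_max tx tb orbT.
    - by rewrite in_itv/= => /andP[xz _] Tz; exists z; split=> //; exact: lt_le_trans xz.
  by [].
have dg t : T x0 <= t -> is_derive t 1 g (Psi (g t)).
  move=> /Tg[ag Tgt]; rewrite -{1}Tgt -[Psi _]invrK.
  have near_a : \forall x \near g t, a < x by exact: lt_nbhsr.
  apply: is_derive_inverse.
  - by near=> x; apply: gT; near: x.
  - by near=> x; apply: der_continuous (dT x _); near: x.
  - exact: dT.
  - by rewrite invr_neq0// gt_eqF.
pose X y := g (T x0 + y).
have dX y : 0 <= y -> is_derive y 1 X (Psi (X y)).
  move=> y0; have := der_comp (dg (T x0 + y) _) (derD (der_cst (T x0) y) (der_id y)).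
  rewrite lerDl => /(_ y0) /derE; apply; by rewrite add0r mulr1.
exists X; split => //; first by rewrite /X addr0 gT.
move=> y; rewrite le_eqVlt => /predU1P[<-|y0].
  by rewrite mulr0 addr0 /X addr0 gT.
have [z /andP[z0 _]|z _] := @mean_value _ X (fun z => Psi (X z)) _ _ y0; first exact: dX.
rewrite {2}/X addr0 gT// subr0 => h.
have /andP[h1 _] := cPC (X z).
have : c * y <= Psi (X z) * y by rewrite ler_pM2r.
lra.
Unshelve. all: by end_near. Qed.

(* Apply the previous lemma to [- ln z], whose speed [Phi z / z] is bounded above
   and away from zero. *)
Lemma linear_decay_solution (Phi : R -> R) (c C z0 : R) : 0 < z0 -> 0 < c ->
  (forall z, 0 < z <= z0 -> {for z, continuous Phi}) ->
  (forall z, 0 < z <= z0 -> c * z <= Phi z <= C * z) ->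
  exists z : R -> R, z 0 = z0 /\ forall y, 0 <= y ->
    [/\ is_derive y 1 z (- Phi (z y)), 0 < z y, z y <= z0 &
       z y <= z0 * expR (- (c * y))].
Proof.
move=> z00 c0 Phic cPC.
(* [m] recovers [z] from [- ln z], cut off at [z0] so that [Phi] is only evaluated on []0, z0]];
   decay keeps the cut-off inactive along the solution. *)
pose m x := Num.min (expR (- x)) z0.
have m0 x : 0 < m x <= z0 by rewrite /m lt_min expR_gt0 z00/= ge_min lexx orbT.
have mc : continuous m.
  move=> x; apply: (@continuous_min R R (fun x => expR (- x)) (fun=> z0)).
    have dN : is_derive x 1 (fun y => - y) (- 1) by exact: is_deriveNid.
    exact: der_continuous (der_comp (is_derive_expR _) dN).
  exact: cst_continuous.
pose Psi x := Phi (m x) / m x.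
have Psic : continuous Psi.
  move=> x; have /andP[mx0 _] := m0 x.
  have h1 : {for x, continuous (fun y => Phi (m y))}.
    by apply: continuous_comp; [exact: mc|exact: Phic].
  have h2 : {for x, continuous (fun y => (m y)^-1)}.
    by apply: continuousV; [rewrite gt_eqF|exact: mc].
  exact: (cvgM h1 h2).
have PsiB x : c <= Psi x <= C.
  have := cPC _ (m0 x); have /andP[mx0 _] := m0 x.
  by rewrite /Psi ler_pdivlMr// ler_pdivrMr.
have [X [X0 dX Xge]] := autonomous_solution (- ln z0) c0 Psic PsiB.
have zle y : 0 <= y -> expR (- X y) <= z0 * expR (- (c * y)).
  move=> y0; rewrite -{1}(lnK z00) -expRD ler_expR; have := Xge _ y0; lra.
have zle0 y : 0 <= y -> expR (- X y) <= z0.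
  move=> y0; apply: (le_trans (zle _ y0)); rewrite ler_piMr ?(ltW z00)//.
  by rewrite -expR0 ler_expR oppr_le0 mulr_ge0// ltW.
exists (fun y => expR (- X y)); split; first by rewrite X0 opprK lnK.
move=> y y0; split; [|exact: expR_gt0|exact: zle0|exact: zle].
have dN : is_derive y 1 (fun y => - X y) (- Psi (X y)).
  by have := dX y y0 => ?; exact: is_deriveN.
apply: (derE (der_comp (is_derive_expR _) dN)).
rewrite /Psi /m min_l ?zle0//; field.
by rewrite gt_eqF// expR_gt0.
Qed.

End autonomous.

(** * Existence and uniqueness of the layer profile *)

Section layer.
Variables (R : realType) (gamma p : R).
Hypotheses (g1 : 1 <= gamma) (p0 : 0 < p).
Implicit Types (x y z b : R) (s : R -> R).
Let f x := enthalpy gamma x - enthalpy gamma p.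

(** The zero-energy relation gives [|s'| = sqrt (2 * H s)], a first-order equation for the distance
    [z] to [p]. Near [p] the speed lies between two multiples of [z], whence exponential decay. The
    bound on [d] keeps the profile within [p / 2] of [p]. *)
Lemma layer_profile (H : R -> R) (c d b : R) : 0 < c -> H p = 0 ->
  (forall x, 0 < x -> is_derive x (1 : R) H (f x)) ->
  (forall x, 0 < x -> c * (x - p) ^+ 2 <= f x * (x - p) * (1 + `|x - p|)) ->
  d ^+ 2 * (1 + p / 2) <= c / 2 * (p / 2) ^+ 2 -> `|b| < d ->
  exists s s1 : R -> R, exists l A : R, [/\ 0 < l, 0 <= A, s1 0 = b,
    forall y, 0 <= y -> is_derive y (1 : R) s (s1 y) /\ is_derive y (1 : R) s1 (f (s y)) &
    forall y, 0 <= y -> [/\ `|s y - p| <= p / 2,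
      `|s y - p| <= A * expR (- (l * y)) & `|s1 y| <= A * expR (- (l * y))]].
Proof.
move=> c0 Hp dH hc dq bd; have q0 : 0 < p / 2 by rewrite divr_gt0.
have q1 : 0 < 1 + p / 2 by rewrite addr_gt0.
have [b0|b0] := eqVneq b 0.
  exists (fun=> p), (fun=> 0), 1, 0; split => //.
    move=> y _; split; first exact: der_cst.
    by rewrite /f subrr; exact: der_cst.
  by move=> y _; rewrite subrr normr0 mul0r lexx (ltW q0).
(* A profile relaxing to [p] with initial slope [b] lies on the side of [p] opposite to the sign of
   [b]. *)
pose sg : R := - Num.sg b.
have sg2 : sg * sg = 1 by rewrite /sg mulrNN -expr2 sqr_sg b0.
have sgn z : 0 <= z -> `|sg * z| = z.
  by move=> z0; rewrite normrM normrN normr_sg b0 mul1r ger0_norm.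
have pz z : 0 <= z -> z <= p / 2 -> p / 2 <= p + sg * z <= 2 * p.
  move=> z0 zq; have := ler_norm (sg * z); have := ler_norm (- (sg * z)).
  by rewrite normrN sgn// => h1 h2; apply/andP; split; lra.
have pz0 z : 0 <= z -> z <= p / 2 -> 0 < p + sg * z.
  by move=> z0 zq; have /andP[h _] := pz _ z0 zq; exact: lt_le_trans h.
have [|m [M [m0 M0 mM]]] := enthalpy_bilipschitz g1 q0 (_ : p / 2 <= 2 * p).
  by lra.
pose K z := H (p + sg * z).
pose c1 := c / 4 / (1 + p / 2).
have c10 : 0 < c1 by rewrite !divr_gt0.
have Kge z : 0 <= z -> z <= p / 2 -> c1 * z ^+ 2 <= K z.
  move=> z0 zq; have h0 := pz0 _ z0 zq.
  have := potential_coercive g1 p0 Hp dH hc h0.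
  rewrite [p + _ - p]addrC addKr sgn// => h.
  have Kz0 : 0 <= K z by exact: (potential_ge0 g1 p0 Hp dH h0).
  have : c / 4 * z ^+ 2 <= K z * (1 + p / 2).
    have -> : z ^+ 2 = (sg * z) ^+ 2 by rewrite expr2 -[z * z]mul1r -sg2; ring.
    by apply: (le_trans h); rewrite ler_wpM2l// lerD2l.
  by move=> h3; rewrite /c1 [leLHS]mulrAC ler_pdivrMr.
have Kle z : 0 <= z -> z <= p / 2 -> K z <= M * z ^+ 2.
  move=> z0 zq; have h0 := pz0 _ z0 zq; have /andP[h1 h2] := pz _ z0 zq.
  apply: (le_trans (potential_le g1 p0 Hp dH h0)).
  have -> : M * z ^+ 2 = M * (p + sg * z - p) * (p + sg * z - p).
    have -> : M * (p + sg * z - p) * (p + sg * z - p) = M * z ^+ 2 * (sg * sg) by ring.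
    by rewrite sg2 mulr1.
  have [xp|px] := leP (p + sg * z) p.
    have /andP[_ h3] := mM (p + sg * z) p h1 xp (ltac:(lra)).
    have : f (p + sg * z) * (p + sg * z - p) = (enthalpy gamma p - enthalpy gamma (p + sg * z)) * (p - (p + sg * z)).
      by rewrite /f; ring.
    rewrite /f => ->.
    have -> : M * (p + sg * z - p) * (p + sg * z - p) = M * (p - (p + sg * z)) * (p - (p + sg * z)) by ring.
    by rewrite ler_wpM2r// subr_ge0.
  have /andP[_ h3] := mM p (p + sg * z) (ltac:(lra)) (ltW px) h2.
  by rewrite ler_wpM2r// subr_ge0 ltW.
have dK z : 0 <= z -> z <= p / 2 -> is_derive z (1 : R) K (f (p + sg * z) * sg).
  move=> z0 zq; have h0 := pz0 _ z0 zq.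
  apply: (derE (@der_comp _ (fun z => p + sg * z) H z _ _ (dH _ h0)
    (derD (der_cst p z) (derZ sg (der_id z))))).
  by rewrite mulr1 add0r.
pose Phi z := Num.sqrt (2 * K z).
have Phic z : 0 <= z -> z <= p / 2 -> {for z, continuous Phi}.
  move=> z0 zq; apply: (@continuous_comp _ _ _ (fun z => 2 * K z) Num.sqrt).
    exact: der_continuous (derZ 2 (dK _ z0 zq)).
  exact: sqrt_continuous.
have Phi0 : Phi 0 = 0 by rewrite /Phi /K mulr0 addr0 Hp mulr0 sqrtr0.
(* Smallness of the slope: coercivity makes [Phi (p / 2)] at least [d], so the intermediate value
   theorem finds an initial distance [z0 <= p / 2] with speed exactly [|b|]. *)
have Phiq : `|b| <= Phi (p / 2).
  rewrite -sqrtr_sqr ler_sqrt; last first.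
    by rewrite mulr_ge0//; apply: le_trans (Kge _ (ltW q0) (lexx _)); rewrite mulr_ge0 ?sqr_ge0// ltW.
  apply: (@le_trans _ _ (d ^+ 2)).
    by rewrite -[b ^+ 2]real_normK ?num_real// lerXn2r ?nnegrE ?normr_ge0 ?(ltW bd)// (le_trans _ (ltW bd)).
  apply: (@le_trans _ _ (2 * (c1 * (p / 2) ^+ 2))); last by rewrite ler_pM2l// Kge// ltW.
  have -> : 2 * (c1 * (p / 2) ^+ 2) = c / 2 * (p / 2) ^+ 2 / (1 + p / 2).
    by rewrite /c1; field; rewrite gt_eqF//; lra.
  by rewrite ler_pdivlMr.
have [||z0] := @IVT _ Phi 0 (p / 2) `|b| (ltW q0).
- apply: continuous_in_subspaceT => z; rewrite inE/= in_itv/= => /andP[? ?].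
  exact: Phic.
- by rewrite Phi0 ge_min le_max normr_ge0 Phiq orbT.
rewrite in_itv/= => /andP[z00 z0q] Phiz0.
have {}z00 : 0 < z0.
  rewrite lt_neqAle z00 andbT; apply/eqP => z0E; move: Phiz0.
  by rewrite -z0E Phi0 => /esym/eqP; rewrite normr_eq0 (negbTE b0).
pose l := Num.sqrt (2 * c1); have l0 : 0 < l by rewrite sqrtr_gt0 mulr_gt0.
pose L := Num.sqrt (2 * M); have L0 : 0 < L by rewrite sqrtr_gt0 mulr_gt0.
have PhiB z : 0 < z <= z0 -> l * z <= Phi z <= L * z.
  move=> /andP[zp zz]; have zq := le_trans zz z0q; have zp0 := ltW zp.
  have K0 : 0 <= 2 * K z.
    by rewrite mulr_ge0//; apply: le_trans (Kge _ zp0 zq); rewrite mulr_ge0 ?sqr_ge0// ltW.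
  have sz (e : R) : 0 <= e -> Num.sqrt e * z = Num.sqrt (e * z ^+ 2).
    by move=> e0; rewrite sqrtrM// sqrtr_sqr ger0_norm.
  have c20 : 0 <= 2 * c1 by rewrite mulr_ge0// ltW.
  have M20 : 0 <= 2 * M by rewrite mulr_ge0// ltW.
  rewrite /l /L (sz _ c20) (sz _ M20) /Phi; apply/andP; split.
    by rewrite ler_sqrt// -mulrA ler_pM2l// Kge.
  rewrite ler_sqrt; first by rewrite -mulrA ler_pM2l// Kle.
  by rewrite !mulr_ge0 ?sqr_ge0// ltW.
have [|z [zE hz]] := @linear_decay_solution _ Phi l L z0 z00 l0 _ PhiB.
  by move=> z /andP[/ltW zp zz]; apply: Phic => //; exact: le_trans z0q.
exists (fun y => p + sg * z y), (fun y => - sg * Phi (z y)), l, (z0 + L * z0).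
have Lz0 : 0 <= L * z0 by rewrite mulr_ge0// ltW.
split.
- exact: l0.
- by rewrite addr_ge0// ltW.
- by rewrite zE Phiz0 /sg opprK -numEsg.
- move=> y y0; have [dz zp zz _] := hz y y0; split.
    by apply: (derE (derD (der_cst p y) (derZ sg dz))); ring.
  have zq := le_trans zz z0q; have Kz0 : 0 < K (z y).
    apply: lt_le_trans (Kge _ (ltW zp) zq); by rewrite mulr_gt0// exprn_gt0.
  have K20 : 0 < 2 * K (z y) by rewrite mulr_gt0.
  have dPhi := @der_comp _ (fun z => 2 * K z) _ _ _ _ (is_derive1_sqrt K20)
    (derZ 2 (dK _ (ltW zp) zq)).
  apply: (derE (derZ (- sg) (der_comp dPhi dz))).
  have P0 : 0 < Phi (z y) by rewrite sqrtr_gt0.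
  rewrite -/(Phi (z y)).
  have -> : - sg * ((2 * Phi (z y))^-1 * (2 * (f (p + sg * z y) * sg)) * - Phi (z y)) =
     sg * sg * f (p + sg * z y) by field; rewrite gt_eqF.
  by rewrite sg2 mul1r.
- move=> y y0; have [_ zp zz ze] := hz y y0.
  have e0 : 0 < expR (- (l * y)) by exact: expR_gt0.
  have e1 : 0 <= z0 * expR (- (l * y)) by rewrite mulr_ge0// ltW.
  have e2 : 0 <= L * z0 * expR (- (l * y)) by rewrite mulr_ge0// ltW.
  rewrite [p + _ - p]addrC addKr sgn ?(ltW zp)//; split.
  + exact: le_trans z0q.
  + by rewrite mulrDl; lra.
  + rewrite normrM normrN normrN normr_sg b0 mul1r ger0_norm ?sqrtr_ge0//.
    have /andP[_ h] := PhiB (z y) (ltac:(by rewrite zp zz)).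
    have : L * z y <= L * (z0 * expR (- (l * y))) by rewrite ler_pM2l.
    by rewrite mulrDl; lra.
Qed.

Lemma layer_solution_of_profile s (s1 : R -> R) (l A b : R) : 0 < l -> s1 0 = b ->
  (forall y, 0 <= y -> is_derive y (1 : R) s (s1 y) /\ is_derive y (1 : R) s1 (f (s y))) ->
  (forall y, 0 <= y -> [/\ `|s y - p| <= p / 2,
      `|s y - p| <= A * expR (- (l * y)) & `|s1 y| <= A * expR (- (l * y))]) ->
  layer_solution gamma p b s.
Proof.
move=> l0 s10 ds sB.
have ds1 y : 0 < y -> is_derive y (1 : R) (s^`())%classic (f (s y)).
  move=> y0; apply: (near_eq_is_derive (f := s1)); last by case: (ds y (ltW y0)).
  near=> t; have t0 : 0 < t by near: t; exact: lt_nbhsr.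
  by have [h _] := ds t (ltW t0); rewrite derive1E derive_val.
split.
- move=> y /sB[h _ _]; move: h; rewrite ler_norml => /andP[h _]; have := p0; lra.
- move=> y y0; split; first by have [h _] := ds y (ltW y0); exact: ex_derive.
  by have h := ds1 y y0; exact: ex_derive.
- by move=> y y0; have h := ds1 y y0; rewrite /= derive1E derive_val.
- have [/is_derive1_caratheodory[h [hE hc h0]] _] := ds 0 (lexx 0).
  rewrite -s10 -h0 /is_right_derive.
  have hc' : h t @[t --> 0^'+] --> h 0 by exact: cvg_at_right_filter.
  apply: cvg_trans hc'; apply: near_eq_cvg; near=> t.
  have t0 : 0 < t by near: t; exact: nbhs_right_gt.
  by rewrite add0r hE subr0 mulfK// gt_eqF.
- apply/cvg_pinfty_distP => e e0; exists (Num.max 0 (A / (e * l))) => t.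
  rewrite gt_max => /andP[t0 tA]; have [_ h _] := sB t (ltW t0).
  apply: (le_lt_trans h); rewrite expRN ltr_pdivrMr ?expR_gt0//.
  have := expR_ge1Dx (l * t).
  move: tA; rewrite ltr_pdivrMr ?mulr_gt0// => tA h1.
  have : e * (1 + l * t) <= e * expR (l * t) by rewrite ler_pM2l.
  lra.
Unshelve. all: by end_near. Qed.

(** Same argument as at the wall for stationary solutions, with constant weight: the equation bounds
    the second derivative near 0. *)
Lemma layer_derivative_cvg s b : layer_solution gamma p b s ->
  (s^`())%classic y @[y --> 0^'+] --> b.
Proof.
case=> pos der eqn rd _; have rc := is_right_derive_cvg rd.
set r0 := s 0; have r00 : 0 < r0 by apply: pos.
have [|d d0 hd] := (cvg_at_right_distP _ _ _).1 rc (r0 / 2); first by rewrite divr_gt0.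
pose C : R := `|enthalpy gamma (r0 / 2)| + `|enthalpy gamma (2 * r0)| + `|enthalpy gamma p|.
have dds y : 0 < y -> is_derive y (1 : R) (s^`())%classic (f (s y)).
  move=> y0; apply: (derE (derivable_is_derive1 (proj2 (der y y0)))).
  exact: eqn.
apply: (@right_derivative_cvg _ s _ (fun=> 1) (fun y => f (s y)) 0 b d C).
- by [].
- by [].
- by move=> y y0; exact: derivable_is_derive1 (proj1 (der y y0)).
- exact: cvg_cst.
- move=> y y0; apply: (derE (derM (der_cst 1 y) (dds y y0))); ring.
move=> y /andP[y0 yd].
have := hd y; rewrite y0 yd => /(_ isT); rewrite ltr_norml => /andP[h1 h2].
rewrite -/r0 in h1 h2.
have p1 : enthalpy gamma (r0 / 2) <= enthalpy gamma (s y).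
  by apply: enthalpy_le => //; lra.
have p2 : enthalpy gamma (s y) <= enthalpy gamma (2 * r0).
  by apply: enthalpy_le => //; lra.
apply: le_trans (ler_normB _ _) _; rewrite lerD2r.
have := ler_norm (enthalpy gamma (2 * r0)).
have := ler_norm (- enthalpy gamma (r0 / 2)); rewrite normrN => h3 h4.
have := normr_ge0 (enthalpy gamma (2 * r0)).
have := normr_ge0 (enthalpy gamma (r0 / 2)) => h5 h6.
by rewrite ler_norml; apply/andP; split; lra.
Qed.

(** By monotonicity of the enthalpy [d * d1] is nondecreasing, and it starts from 0 because the
    initial slopes agree. Hence [d ^ 2] is nondecreasing, and its limit at infinity is 0. *)
Lemma layer_solution_unique s (s' : R -> R) b : layer_solution gamma p b s ->
  layer_solution gamma p b s' -> forall y, 0 <= y -> s' y = s y.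
Proof.
move=> S S'; have c := layer_derivative_cvg S; have c' := layer_derivative_cvg S'.
case: S => pos der eqn rd lim; case: S' => pos' der' eqn' rd' lim'.
have rc := is_right_derive_cvg rd; have rc' := is_right_derive_cvg rd'.
pose d y := s' y - s y; pose d1 y := (s'^`())%classic y - (s^`())%classic y.
have dd y : 0 < y -> is_derive y (1 : R) d (d1 y).
  move=> y0; exact: (derB (derivable_is_derive1 (proj1 (der' y y0)))
    (derivable_is_derive1 (proj1 (der y y0)))).
have dd1 y : 0 < y -> is_derive y (1 : R) d1 (f (s' y) - f (s y)).
  move=> y0; apply: (derE (derB (derivable_is_derive1 (proj2 (der' y y0)))
    (derivable_is_derive1 (proj2 (der y y0))))).
  by rewrite /f -(eqn y y0) -(eqn' y y0).
have P y : 0 < y -> 0 <= d y * d1 y.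
  apply: (@nondecreasing_ge_right _ (fun y => d y * d1 y) 0 0).
    have dP (t : R) : 0 < t -> is_derive t (1 : R) (fun y => d y * d1 y)
        (d1 t * d1 t + d t * (f (s' t) - f (s t))).
      by move=> t0; exact: (derM (dd t t0) (dd1 t t0)).
    apply: (derive_ge0_le dP) => t t0.
    rewrite addr_ge0 -?expr2 ?sqr_ge0// mulrC.
    have -> : (f (s' t) - f (s t)) * d t =
        (enthalpy gamma (s' t) - enthalpy gamma (s t)) * (s' t - s t).
      by rewrite /f /d; ring.
    exact: enthalpy_monotone g1 (pos' t (ltW t0)) (pos t (ltW t0)).
  rewrite -[X in _ --> X](mulr0 (s' 0 - s 0)) -[X in _ * X](subrr b).
  by apply: cvgM; apply: cvgB.
have d0 y : 0 < y -> d y = 0.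
  move=> y0; apply/eqP; rewrite -sqrf_eq0 eq_le sqr_ge0 andbT.
  apply: (@nondecreasing_le_pinfty _ (fun y => d y ^+ 2) 0 0) => //.
    apply: (@derive_ge0_le _ _ (fun y => 2 * d y ^+ 1 * d1 y)) => t t0.
      by apply: derX; exact: dd.
    by rewrite expr1 -mulrA mulr_ge0// P.
  have h : d y @[y --> +oo] --> (0 : R) by rewrite -(subrr p); exact: cvgB.
  by rewrite -[X in _ --> X](mulr0 0) -expr2; exact: cvg_sqr.
move=> y; rewrite le_eqVlt => /predU1P[<-|/d0/eqP]; last by rewrite subr_eq0 => /eqP.
(* The equations hold only for positive [y]; the value at 0 follows by right continuity. *)
have h : s' t @[t --> 0^'+] --> s 0.
  apply: cvg_trans rc; apply: near_eq_cvg.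
  near=> t; have t0 : 0 < t by near: t; exact: nbhs_right_gt.
  by have /eqP := d0 t t0; rewrite subr_eq0 => /eqP.
exact: (cvg_unique _ rc' h).
Unshelve. all: by end_near. Qed.

End layer.

(** * Singularly scaled boundary slope *)

Section scaled_slope.
Variable R : realType.
Implicit Types (r s t y : R).

Lemma eq_L2r_norm n (f g : R -> R) : (forall r, 1 < r -> f r = g r) ->
  L2r_norm n f = L2r_norm n g.
Proof.
move=> fg; rewrite /L2r_norm; congr (_ `^ _)%E; apply: eq_integral => r.
by rewrite inE/= in_itv/= andbT => /fg ->.
Qed.

(** Linear growth is absorbed at rate [l / (k + 1)] by [1 + x <= expR x], then raised to the power
    [k]; dividing by [k + 1] also covers [k = 0]. *)
Lemma pow_le_expR k (l : R) : 0 < l ->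
  exists2 K : R, 0 < K & forall r, 1 <= r -> r ^+ k <= K * expR (l * (r - 1)).
Proof.
move=> l0; pose be : R := l / k.+1%:R; have be0 : 0 < be by rewrite divr_gt0.
pose N : R := 1 + be^-1; have N1 : 1 <= N by rewrite lerDl invr_ge0 ltW.
exists (N ^+ k); first by rewrite exprn_gt0// (lt_le_trans _ N1).
move=> r r1; have r10 : 0 <= r - 1 by rewrite subr_ge0.
have h : r <= N * expR (be * (r - 1)).
  apply: (@le_trans _ _ (N * (1 + be * (r - 1)))); last first.
    by rewrite ler_wpM2l ?expR_ge1Dx// (le_trans _ N1).
  have -> : N * (1 + be * (r - 1)) = r + be^-1 + be * (r - 1).
    by rewrite /N; field; rewrite gt_eqF.
  have : 0 <= be * (r - 1) by rewrite mulr_ge0// ltW.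
  have : 0 < be^-1 by rewrite invr_gt0.
  lra.
apply: (@le_trans _ _ ((N * expR (be * (r - 1))) ^+ k)).
  by apply: lerXn2r h; rewrite nnegrE ?mulr_ge0 ?expR_ge0//; lra.
rewrite exprMn; apply: ler_wpM2l; first by rewrite exprn_ge0// (le_trans _ N1).
rewrite -expRM_natl ler_expR mulrA; apply: ler_wpM2r => //.
rewrite /be mulrCA ler_piMr ?(ltW l0)// ler_pdivrMr// mul1r ler_nat.
exact: leqnSn.
Qed.

Variables (n : nat) (gamma p : R).
Hypotheses (g1 : 1 <= gamma) (p0 : 0 < p).
Let f x := enthalpy gamma x - enthalpy gamma p.

(** With wall slope [b / a ^ 2] the flux estimate gives [kappa * drho ^ 2 <= b ^ 2] uniformly in
    [kappa], and the energy bound with the smallness of [d] confines [rho] to the range where the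
    enthalpy is bilipschitz. *)
Lemma stationary_close (H : R -> R) (c d b a : R) rho : 0 < c -> 0 < a -> H p = 0 ->
  (forall x : R, 0 < x -> is_derive x (1 : R) H (f x)) ->
  (forall x, 0 < x -> c * (x - p) ^+ 2 <= f x * (x - p) * (1 + `|x - p|)) ->
  d ^+ 2 * (1 + p / 2) <= c / 2 * (p / 2) ^+ 2 -> `|b| < d ->
  stationary_solution n gamma p (a ^+ 4) (b / a ^+ 2) rho ->
  forall r, 1 < r -> `|rho r - p| <= p / 2.
Proof.
move=> c0 a0 Hp dH hc dq bd sol r r1; have k0 : 0 < a ^+ 4 by rewrite exprn_gt0.
have q0 : 0 < p / 2 by rewrite divr_gt0.
have rr0 := stationary_gt0 sol (ltW r1).
have a20 : 0 < a ^+ 2 by rewrite exprn_gt0.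
have h1 := stationary_energy p0 k0 sol Hp dH r1.
have h2 := potential_coercive g1 p0 Hp dH hc rr0.
have h3 := stationary_slope_le g1 p0 k0 sol r1.
rewrite normrM normfV (gtr0_norm a20) ler_pdivlMr// in h3.
have d0 : 0 <= d by exact: le_trans (ltW bd).
have h4 : a ^+ 4 * ((rho^`())%classic r) ^+ 2 <= d ^+ 2.
  have -> : a ^+ 4 * ((rho^`())%classic r) ^+ 2 = (`|(rho^`())%classic r| * a ^+ 2) ^+ 2.
    by rewrite -[in LHS](real_normK (num_real _)); ring.
  apply: lerXn2r; rewrite ?nnegrE//; first by rewrite mulr_ge0// ltW.
  exact: le_trans h3 (ltW bd).
set u := `|rho r - p|; have u0 : 0 <= u by exact: normr_ge0.
rewrite -[(rho r - p) ^+ 2]real_normK ?num_real// -/u in h2.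
rewrite leNgt; apply/negP => qu; set q := p / 2 in q0 dq qu.
have h5 : c / 4 * u ^+ 2 <= d ^+ 2 / 2 * (1 + u).
  by apply: (le_trans h2); rewrite ler_wpM2r ?addr_ge0//; lra.
have h6 : c / 4 * u ^+ 2 * (1 + q) <= d ^+ 2 / 2 * (1 + u) * (1 + q).
  by rewrite ler_wpM2r// addr_ge0// ltW.
have h7 : d ^+ 2 * (1 + q) * ((1 + u) / 2) <= c / 2 * q ^+ 2 * ((1 + u) / 2).
  by rewrite ler_wpM2r// divr_ge0// addr_ge0.
(* The product of the last two factors is [u ^ 2 * (1 + q) - q ^ 2 * (1 + u)], which [h6] and [h7]
   would make nonpositive. *)
have h8 : 0 < c / 4 * ((u - q) * (u + q + u * q)).
  rewrite mulr_gt0 ?divr_gt0// mulr_gt0 ?subr_gt0//.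
  by rewrite addr_gt0 ?mulr_gt0 ?addr_gt0// (lt_trans q0).
lra.
Qed.

Variables (sb s1 : R -> R) (l A b : R).
Hypotheses (l0 : 0 < l) (A0 : 0 <= A) (s10 : s1 0 = b).
Hypothesis dsb : forall y, 0 <= y ->
  is_derive y (1 : R) sb (s1 y) /\ is_derive y (1 : R) s1 (f (sb y)).
Hypothesis sbB : forall y, 0 <= y -> [/\ `|sb y - p| <= p / 2,
  `|sb y - p| <= A * expR (- (l * y)) & `|s1 y| <= A * expR (- (l * y))].
Notation k := n.-1.

(* The curvature term [(n - 1) / r v'] of the layer [v] is the only forcing of
   the difference; Young's inequality absorbs its product with the difference
   into the restoring term, up to a quantity integrable on the layer scale. *)
Lemma scaled_slope_estimates (amax : R) : 0 < amax ->
  exists2 C : R, 0 < C & forall a rho, 0 < a -> a <= amax ->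
    stationary_solution n gamma p (a ^+ 4) (b / a ^+ 2) rho ->
    (forall r, 1 < r -> `|rho r - p| <= p / 2) ->
    let w := fun r => rho r - sb ((r - 1) / a ^+ 2) in
    [/\ (L2r_norm n w <= (C * a ^+ 3)%:E)%E,
        (L2r_norm n (w^`())%classic <= (C * a)%:E)%E
      & (Linfty_norm w <= (C * a ^+ 2)%:E)%E].
Proof.
move=> am0; have q0 : 0 < p / 2 by rewrite divr_gt0.
have [|m [M [m0 _ mM]]] := enthalpy_bilipschitz g1 q0 (_ : p / 2 <= 2 * p).
  by lra.
have am20 : 0 < amax ^+ 2 by rewrite exprn_gt0.
(* Since [a <= amax], the layer decays at rate at least [l / amax ^ 2] in [r], so one [K] absorbs
   the radial weight for all admissible [a]. *)
have [K K0 hK] := pow_le_expR k (divr_gt0 l0 am20).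
pose D : R := k%:R ^+ 2 * A ^+ 2 * K / (2 * m).
have D0 : 0 <= D.
  by rewrite divr_ge0 ?mulr_ge0 ?sqr_ge0 ?(ltW K0) ?(ltW m0).
pose C0 : R := D / l * (2 / m + 1).
have m20 : 0 < 2 / m by rewrite divr_gt0.
have Dl0 : 0 <= D / l by rewrite divr_ge0// ltW.
have Dlm0 : 0 <= D / l * (2 / m) by rewrite mulr_ge0// ltW.
pose C : R := 1 + C0.
have C1 : 1 <= C by rewrite /C /C0 mulrDr; lra.
have CC (x : R) : 0 <= x -> x <= C0 -> x <= C ^+ 2.
  move=> x0 xC; apply: (@le_trans _ _ C); first by rewrite /C; lra.
  by rewrite expr2 ler_peMl//; lra.
exists C; first by lra.
move=> a rho a0 aam sol close w; have k0 : 0 < a ^+ 4 by rewrite exprn_gt0.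
have a20 : 0 < a ^+ 2 by rewrite exprn_gt0.
pose Y r := (r - 1) / a ^+ 2.
have Y0 r : 1 <= r -> 0 <= Y r by move=> r1; rewrite divr_ge0 ?subr_ge0// ltW.
pose v r := sb (Y r); pose v1 r := s1 (Y r) / a ^+ 2.
pose drho := (rho^`())%classic; pose ddrho := (rho^`(2))%classic.
pose w1 r := drho r - v1 r.
have dv r : 1 <= r -> is_derive r (1 : R) v (v1 r).
  move=> r1; have [h _] := dsb (Y0 _ r1).
  exact: (@der_comp _ Y sb r _ _ h (der_affine 1 (a ^+ 2)^-1 r)).
have dv1 r : 1 <= r -> is_derive r (1 : R) v1 (f (v r) / a ^+ 4).
  move=> r1; have [_ h] := dsb (Y0 _ r1).
  have h2 := @der_comp _ Y s1 r _ _ h (der_affine 1 (a ^+ 2)^-1 r).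
  apply: (derE (derM h2 (der_cst (a ^+ 2)^-1 r))).
  by rewrite mulr0 addr0 /v; field; rewrite gt_eqF.
have dw r : 1 < r -> is_derive r (1 : R) w (w1 r).
  by move=> r1; apply: derB; [exact: (stationary_derive sol r1)|exact: dv (ltW r1)].
have dw1 r : 1 < r -> is_derive r (1 : R) w1 (ddrho r - f (v r) / a ^+ 4).
  by move=> r1; apply: derB; [exact: (stationary_derive2 sol r1)|exact: dv1 (ltW r1)].
pose F1 r := r ^+ k * w1 r * w r.
pose E r := expR (- (l / a ^+ 2 * (r - 1))).
pose dF1 r := r ^+ k * (w1 r ^+ 2 + (f (rho r) - f (v r)) / a ^+ 4 * w r - k%:R / r * v1 r * w r).
have dF1P r : 1 < r -> is_derive r (1 : R) F1 (dF1 r).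
  move=> r1; have r0 : 0 < r by exact: lt_trans r1.
  have rn0 : r != 0 by rewrite gt_eqF.
  apply: (derE (derM (der_flux k rn0 (dw1 _ r1)) (dw _ r1))).
  have h : ddrho r = f (rho r) / a ^+ 4 - k%:R / r * drho r.
    rewrite -[f _](stationary_ode p0 k0 sol r1) /radial_laplacian -/drho -/ddrho.
    by rewrite [a ^+ 4 * _]mulrC mulfK ?gt_eqF//; ring.
  by rewrite h /dF1 /w1; ring.
(* The correction is a primitive of [D * E], the bound on what the curvature forcing leaves after
   Young's inequality; with it the moment becomes nondecreasing. *)
pose F r := F1 r - D * (a ^+ 2 / l) * E r.
pose dF r := dF1 r + D * E r.
have dE r : is_derive r (1 : R) E (E r * - (l / a ^+ 2)).
  have h := der_affine 1 (- (l / a ^+ 2)) r.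
  have -> : E = fun r => expR ((r - 1) * - (l / a ^+ 2)).
    by apply/funext => x; rewrite /E; congr expR; ring.
  exact: der_comp (is_derive_expR _) h.
have dFP r : 1 < r -> is_derive r (1 : R) F (dF r).
  move=> r1; apply: (derE (derB (dF1P _ r1) (derZ (D * (a ^+ 2 / l)) (dE r)))).
  by rewrite /dF; field; rewrite !gt_eqF.
have EY r : expR (- (l * Y r)) = E r by congr expR; rewrite /Y; ring.
have v1B r : 1 <= r -> `|v1 r| <= A * E r / a ^+ 2.
  move=> r1; have [_ _] := sbB (Y0 _ r1); rewrite EY => h.
  by rewrite normrM normfV (gtr0_norm a20) ler_pM2r ?invr_gt0.
have E0 r : 0 < E r by exact: expR_gt0.
have kE r : 1 <= r -> r ^+ k * E r <= K.
  move=> r1; rewrite /E expRN ler_pdivrMr ?expR_gt0//; apply: (le_trans (hK _ r1)).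
  rewrite ler_pM2l// ler_expR ler_wpM2r ?subr_ge0// ler_pM2l// lef_pV2 ?posrE//.
  by apply: lerXn2r; rewrite ?nnegrE// ltW.
have rk r : 1 < r -> 1 <= r ^+ k by move=> r1; rewrite exprn_ege1// ltW.
(* Both [rho] and the layer lie within [p / 2] of [p], where the enthalpy has slope at least [m]. *)
have slope r : 1 < r -> m * w r ^+ 2 <= (f (rho r) - f (v r)) * w r.
  move=> r1; have := close _ r1; have [+ _ _] := sbB (Y0 _ (ltW r1)).
  rewrite !ler_norml -/(v r) => /andP[h1 h2] /andP[h3 h4].
  have fE : f (rho r) - f (v r) = enthalpy gamma (rho r) - enthalpy gamma (v r).
    by rewrite /f; ring.
  have wE : w r = rho r - v r by [].
  rewrite fE wE expr2 mulrA; have [rv|vr] := leP (rho r) (v r).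
    have /andP[h _] := mM (rho r) (v r) (ltac:(lra)) rv (ltac:(lra)).
    have h5 : 0 <= v r - rho r by rewrite subr_ge0.
    have := ler_wpM2r h5 h; lra.
  have /andP[h _] := mM (v r) (rho r) (ltac:(lra)) (ltW vr) (ltac:(lra)).
  by apply: ler_wpM2r h; rewrite subr_ge0 ltW.
have m2 : 0 < 2 * m by rewrite mulr_gt0.
have ma0 : 0 <= m / (2 * a ^+ 4).
  by apply: divr_ge0; [exact: ltW|apply: mulr_ge0 => //; exact: ltW].
have dFge r : 1 < r -> r ^+ k * w1 r ^+ 2 + m / (2 * a ^+ 4) * (r ^+ k * w r ^+ 2) <= dF r.
  move=> r1; have r0 : 0 < r by exact: lt_trans r1.
  have rk0 : 0 <= r ^+ k by exact: le_trans (rk _ r1).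
  have young : k%:R / r * v1 r * w r <=
      m / (2 * a ^+ 4) * w r ^+ 2 + a ^+ 4 * k%:R ^+ 2 / (2 * m) * v1 r ^+ 2.
    have e1 : k%:R / r <= (k%:R : R).
      by rewrite ler_pdivrMr// ler_peMr// ltW.
    have e2 : 0 <= (k%:R / r : R) by rewrite divr_ge0// ltW.
    have e3 : k%:R / r * v1 r * w r <= k%:R * `|v1 r| * `|w r|.
      apply: (le_trans (ler_norm _)).
      rewrite (normrM (k%:R / r * v1 r)) (normrM (k%:R / r)) (ger0_norm e2).
      by apply: ler_wpM2r => //; exact: ler_wpM2r.
    apply: (le_trans e3).
    (* The square is balanced so that exactly half of the restoring term [m / a ^ 4 * w ^ 2] is
       spent. *)
    have e4 : 0 <= m / (2 * a ^+ 4) * (`|w r| - a ^+ 4 * k%:R / m * `|v1 r|) ^+ 2.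
      exact: mulr_ge0 ma0 (sqr_ge0 _).
    rewrite -subr_ge0; apply: (le_trans e4).
    rewrite -[in leRHS](real_normK (num_real (w r))) -[in leRHS](real_normK (num_real (v1 r))).
    rewrite le_eqVlt; apply/orP; left; apply/eqP.
    by field; rewrite !gt_eqF.
  have h1 := slope _ r1.
  have h2 : m / a ^+ 4 * w r ^+ 2 <= (f (rho r) - f (v r)) / a ^+ 4 * w r.
    have -> : m / a ^+ 4 * w r ^+ 2 = m * w r ^+ 2 / a ^+ 4 by ring.
    have -> : (f (rho r) - f (v r)) / a ^+ 4 * w r = (f (rho r) - f (v r)) * w r / a ^+ 4 by ring.
    by rewrite ler_pM2r ?invr_gt0.
  have h3 : v1 r ^+ 2 <= A ^+ 2 * E r ^+ 2 / a ^+ 4.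
    have -> : A ^+ 2 * E r ^+ 2 / a ^+ 4 = (A * E r / a ^+ 2) ^+ 2.
      by field; rewrite gt_eqF.
    rewrite -(real_normK (num_real (v1 r))); apply: lerXn2r; rewrite ?nnegrE//.
      by apply: divr_ge0 (ltW a20); exact: mulr_ge0 A0 (ltW (E0 r)).
    exact: v1B (ltW r1).
  have h4 : a ^+ 4 * k%:R ^+ 2 / (2 * m) * v1 r ^+ 2 <= k%:R ^+ 2 * A ^+ 2 / (2 * m) * E r ^+ 2.
    have -> : k%:R ^+ 2 * A ^+ 2 / (2 * m) * E r ^+ 2 =
       a ^+ 4 * k%:R ^+ 2 / (2 * m) * (A ^+ 2 * E r ^+ 2 / a ^+ 4).
      by field; rewrite !gt_eqF.
    apply: ler_wpM2l h3; apply: divr_ge0 (ltW m2).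
    exact: mulr_ge0 (ltW k0) (sqr_ge0 _).
  (* One factor [E] absorbs the weight [r ^ k]; the other remains to be integrated over the
     layer. *)
  have h5 : r ^+ k * (k%:R ^+ 2 * A ^+ 2 / (2 * m) * E r ^+ 2) <= D * E r.
    have -> : r ^+ k * (k%:R ^+ 2 * A ^+ 2 / (2 * m) * E r ^+ 2) =
       k%:R ^+ 2 * A ^+ 2 / (2 * m) * (r ^+ k * E r) * E r by ring.
    have -> : D * E r = k%:R ^+ 2 * A ^+ 2 / (2 * m) * K * E r by rewrite /D; ring.
    apply: ler_wpM2r; first exact: ltW.
    apply: ler_wpM2l; last exact: kE (ltW r1).
    by apply: divr_ge0 (ltW m2); exact: mulr_ge0 (sqr_ge0 _) (sqr_ge0 _).
  have h6 : w1 r ^+ 2 + m / (2 * a ^+ 4) * w r ^+ 2 <=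
      w1 r ^+ 2 + (f (rho r) - f (v r)) / a ^+ 4 * w r - k%:R / r * v1 r * w r +
      k%:R ^+ 2 * A ^+ 2 / (2 * m) * E r ^+ 2.
    have e : m / a ^+ 4 * w r ^+ 2 = m / (2 * a ^+ 4) * w r ^+ 2 + m / (2 * a ^+ 4) * w r ^+ 2.
      by field; rewrite gt_eqF.
    rewrite e in h2; lra.
  have := ler_wpM2l rk0 h6; rewrite /dF /dF1; lra.
have wB r : 1 < r -> `|w r| <= p.
  move=> r1; have := close _ r1; have [+ _ _] := sbB (Y0 _ (ltW r1)).
  rewrite !ler_norml -/(v r) => /andP[h1 h2] /andP[h3 h4].
  have wE : w r = rho r - v r by [].
  by rewrite wE; apply/andP; split; lra.
have dF0 r : 1 < r -> 0 <= dF r.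
  move=> r1; apply: le_trans (dFge _ r1).
  have rk0 : 0 <= r ^+ k by exact: le_trans (rk _ r1).
  apply: addr_ge0; first exact: mulr_ge0 rk0 (sqr_ge0 _).
  by apply: mulr_ge0 ma0 _; exact: mulr_ge0 rk0 (sqr_ge0 _).
have Fle := derive_ge0_le dFP dF0.
have wcvg : w t @[t --> +oo] --> (0 : R).
  have vcvg : v t @[t --> +oo] --> p.
    apply/cvg_pinfty_distP => e e0; exists (Num.max 1 (1 + A * a ^+ 2 / (e * l))) => t.
    rewrite gt_max => /andP[t1 tA]; have [_ h _] := sbB (Y0 _ (ltW t1)).
    apply: (le_lt_trans h); rewrite expRN ltr_pdivrMr ?expR_gt0//.
    have h1 := expR_ge1Dx (l * Y t).
    have h2 : A < e * (l * Y t).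
      have -> : e * (l * Y t) = (t - 1) * (e * l) / a ^+ 2 by rewrite /Y; ring.
      by rewrite ltr_pdivlMr// -ltr_pdivrMr ?mulr_gt0// ltrBrDl.
    have : e * (1 + l * Y t) <= e * expR (l * Y t) by rewrite ler_pM2l.
    lra.
  by rewrite -(subrr p); apply: cvgB => //; exact: stationary_cvg sol.
(* [F] is nondecreasing and at most [F1], which tends to 0 at infinity: the weighted slope
   difference is bounded and [w] vanishes there. *)
have FB r : 1 < r -> F r <= 0.
  move=> r1; pose B := `|b / a ^+ 2| + A * K / a ^+ 2.
  have B0 : 0 <= B.
    apply: addr_ge0 => //; apply: divr_ge0 (ltW a20).
    exact: mulr_ge0 A0 (ltW K0).
  apply/ler_addgt0Pr => e e0.
  have [|T hT] := (cvg_pinfty_distP _ _).1 wcvg (e / (B + 1)).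
    by rewrite divr_gt0// ltr_wpDl.
  pose t := Num.max r (T + 1); have rt : r <= t by rewrite le_max lexx.
  have t1 : 1 < t by exact: lt_le_trans rt.
  have /hT : T < t by rewrite /t lt_max ltrDl ltr01 orbT.
  rewrite subr0 ltr_pdivlMr ?ltr_wpDl// => wt.
  apply: (le_trans (Fle _ _ r1 rt)).
  have h1 : F t <= F1 t.
    by rewrite gerBl mulr_ge0 ?(ltW (E0 t))// mulr_ge0// divr_ge0// ltW.
  apply: (le_trans h1); rewrite add0r; apply: (le_trans (ler_norm _)).
  have h2 : t ^+ k * `|w1 t| <= B.
    have rk0 : 0 <= t ^+ k by exact: le_trans (rk _ t1).
    apply: (@le_trans _ _ (t ^+ k * (`|drho t| + `|v1 t|))).
      by apply: ler_wpM2l => //; exact: ler_normB.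
    rewrite mulrDr lerD//; first exact: (stationary_flux_le g1 p0 k0 sol t1).
    apply: (@le_trans _ _ (t ^+ k * (A * E t / a ^+ 2))).
      by apply: ler_wpM2l => //; exact: v1B (ltW t1).
    have -> : t ^+ k * (A * E t / a ^+ 2) = A / a ^+ 2 * (t ^+ k * E t) by ring.
    have -> : A * K / a ^+ 2 = A / a ^+ 2 * K by ring.
    by apply: ler_wpM2l; [rewrite divr_ge0// ltW|exact: kE (ltW t1)].
  rewrite /F1 !normrM (ger0_norm (le_trans ler01 (rk _ t1))).
  have h3 := ler_wpM2r (normr_ge0 (w t)) h2.
  have : 0 <= `|w t| by exact: normr_ge0.
  lra.
(* At the wall the slopes of [rho] and of the layer agree, so [F1] tends to 0 and only the
   correction remains. *)
have FB1 r : 1 < r -> - (D * (a ^+ 2 / l)) <= F r.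
  apply: (nondecreasing_ge_right Fle); rewrite /F.
  have cont (g : R -> R) (x y : R) : is_derive x (1 : R) g y -> g t @[t --> x^'+] --> g x.
    by move=> h; exact: cvg_at_right_filter (der_continuous h).
  rewrite -[X in _ --> X]add0r; apply: cvgB.
    have w1c : w1 t @[t --> 1^'+] --> (0 : R).
      have h : v1 1 = b / a ^+ 2 by rewrite /v1 /Y subrr mul0r s10.
      rewrite -(subrr (b / a ^+ 2)) -[X in _ - X]h; apply: cvgB.
        exact: (stationary_derivative_cvg g1 p0 k0 sol).
      exact: cont (dv1 1 (lexx 1)).
    have wc : w t @[t --> 1^'+] --> rho 1 - v 1.
      apply: cvgB; last exact: cont (dv 1 (lexx 1)).
      by case: sol => _ _ _ rd _; exact: is_right_derive_cvg rd.
    have rc : t ^+ k @[t --> 1^'+] --> (1 : R).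
      rewrite -[X in _ --> X](expr1n _ k).
      by apply: cvg_at_right_filter; exact: exprn_continuous.
    have := cvgM (cvgM rc w1c) wc; rewrite mulr0 mul0r; exact.
  rewrite -[X in _ --> X]mulr1; apply: cvgM; first exact: cvg_cst.
  have E1 : E 1 = 1 by rewrite /E subrr mulr0 oppr0 expR0.
  rewrite -[X in _ --> X]E1; exact: cont (dE 1).
pose KK := D / l * a ^+ 2; have KK0 : 0 <= KK by rewrite mulr_ge0// ltW.
have Fdiff s t : 1 < s -> s <= t -> F t - F s <= KK.
  move=> s1' st; have t1 := lt_le_trans s1' st.
  have := FB _ t1; have := FB1 _ s1'.
  have -> : D * (a ^+ 2 / l) = KK by rewrite /KK; ring.
  lra.
have Ca (j : nat) : 0 <= C * a ^+ j by rewrite mulr_ge0 ?exprn_ge0 ?(ltW a0)//; lra.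
have e40 : 0 <= 2 * a ^+ 4 / m.
  by apply: divr_ge0 (ltW m0); apply: mulr_ge0 => //; exact: ltW.
have wle r : 1 < r -> r ^+ k * w r ^+ 2 <= 2 * a ^+ 4 / m * dF r.
  move=> r1; have := dFge _ r1; have rk0 : 0 <= r ^+ k by exact: le_trans (rk _ r1).
  have : 0 <= r ^+ k * w1 r ^+ 2 by exact: mulr_ge0 rk0 (sqr_ge0 _).
  move=> h1 h2; have h3 : m / (2 * a ^+ 4) * (r ^+ k * w r ^+ 2) <= dF r by lra.
  have := ler_wpM2l e40 h3.
  have -> // : 2 * a ^+ 4 / m * (m / (2 * a ^+ 4) * (r ^+ k * w r ^+ 2)) = r ^+ k * w r ^+ 2.
  by field; rewrite !gt_eqF.
have w1le r : 1 < r -> r ^+ k * w1 r ^+ 2 <= dF r.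
  move=> r1; have := dFge _ r1; have rk0 : 0 <= r ^+ k by exact: le_trans (rk _ r1).
  have : 0 <= m / (2 * a ^+ 4) * (r ^+ k * w r ^+ 2).
    by apply: mulr_ge0 ma0 _; exact: mulr_ge0 rk0 (sqr_ge0 _).
  lra.
split.
- apply: (@L2r_norm_le _ n w (fun r => 2 * a ^+ 4 / m * F r)
    (fun r => 2 * a ^+ 4 / m * dF r) _ (2 * a ^+ 4 / m * KK)); first exact: Ca.
  + have -> : 2 * a ^+ 4 / m * KK = D / l * (2 / m) * (a ^+ 3) ^+ 2 by rewrite /KK; ring.
    have -> : (C * a ^+ 3) ^+ 2 = C ^+ 2 * (a ^+ 3) ^+ 2 by ring.
    apply: ler_wpM2r; first exact: sqr_ge0.
    by apply: CC => //; rewrite /C0 mulrDr; lra.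
  + by move=> r r1; exact: der_continuous (dw _ r1).
  + by move=> r r1; apply: derZ; exact: dFP.
  + by move=> r r1; rewrite mulrC; exact: wle.
  + by move=> s t s1' st; rewrite -mulrBr; apply: ler_wpM2l => //; exact: Fdiff.
- rewrite (@eq_L2r_norm n _ w1); last first.
    by move=> r r1; rewrite derive1E; have := dw _ r1 => ?; exact: derive_val.
  apply: (@L2r_norm_le _ n w1 F dF (C * a) KK _ _ _ dFP).
  + by have := Ca 1%N; rewrite expr1.
  + have -> : (C * a) ^+ 2 = C ^+ 2 * a ^+ 2 by ring.
    apply: ler_wpM2r; first exact: sqr_ge0.
    by apply: CC => //; rewrite /C0 mulrDr; lra.
  + by move=> r r1; exact: der_continuous (dw1 _ r1).
  + by move=> r r1; rewrite mulrC; exact: w1le.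
  + exact: Fdiff.
- apply: Linfty_norm_le; first exact: Ca.
  (* By Young, [- 2 * w * w1] is at most [w ^ 2 / a ^ 2 + a ^ 2 * w1 ^ 2], hence at most [e * dF].
     So [w ^ 2 + e * F] is nondecreasing, and letting the upper point go to infinity bounds [w ^ 2]
     by [e * KK]. *)
  move=> r r1; pose e : R := a ^+ 2 * (2 / m + 1).
  have e0 : 0 <= e by rewrite mulr_ge0 ?sqr_ge0//; lra.
  have mono : forall s t, 1 < s -> s <= t -> w s ^+ 2 + e * F s <= w t ^+ 2 + e * F t.
    apply: (@derive_ge0_le _ (fun x => w x ^+ 2 + e * F x)
      (fun x => 2 * w x ^+ 1 * w1 x + e * dF x)) => x x1.
      by apply: derD; [apply: derX; exact: dw|apply: derZ; exact: dFP].
    have h1 := wle _ x1; have h2 := w1le _ x1.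
    have h3 : w x ^+ 2 <= 2 * a ^+ 4 / m * dF x.
      by apply: le_trans h1; rewrite ler_peMl ?sqr_ge0// rk.
    have h4 : w1 x ^+ 2 <= dF x.
      by apply: le_trans h2; rewrite ler_peMl ?sqr_ge0// rk.
    have h5 : 0 <= (a ^+ 2)^-1 * (w x + a ^+ 2 * w1 x) ^+ 2.
      by apply: mulr_ge0 (sqr_ge0 _); rewrite invr_ge0 ltW.
    have h6 : (a ^+ 2)^-1 * w x ^+ 2 <= (a ^+ 2)^-1 * (2 * a ^+ 4 / m * dF x).
      by apply: ler_wpM2l h3; rewrite invr_ge0 ltW.
    have h7 : a ^+ 2 * w1 x ^+ 2 <= a ^+ 2 * dF x by apply: ler_wpM2l h4; exact: ltW.
    have h8 : (a ^+ 2)^-1 * (w x + a ^+ 2 * w1 x) ^+ 2 =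
       (a ^+ 2)^-1 * w x ^+ 2 + 2 * w x * w1 x + a ^+ 2 * w1 x ^+ 2.
      by field; rewrite gt_eqF.
    have h9 : (a ^+ 2)^-1 * (2 * a ^+ 4 / m * dF x) = a ^+ 2 * (2 / m) * dF x.
      by field; rewrite !gt_eqF.
    rewrite h8 in h5; rewrite h9 in h6.
    have h10 : e * dF x = a ^+ 2 * (2 / m) * dF x + a ^+ 2 * dF x by rewrite /e; ring.
    rewrite expr1 h10; lra.
  have w2 : w r ^+ 2 <= e * KK.
    apply/ler_addgt0Pr => e' e'0.
    have wcvg2 : w t ^+ 2 @[t --> +oo] --> (0 : R).
      by rewrite -[X in _ --> X](mulr0 0) -expr2; exact: cvg_sqr.
    have [T hT] := (cvg_pinfty_distP _ _).1 wcvg2 e' e'0.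
    pose t := Num.max r (T + 1); have rt : r <= t by rewrite le_max lexx.
    have /hT : T < t by rewrite /t lt_max ltrDl ltr01 orbT.
    rewrite subr0 ger0_norm ?sqr_ge0// => wt.
    have := mono _ _ r1 rt; have := ler_wpM2l e0 (Fdiff _ _ r1 rt); lra.
  have : w r ^+ 2 <= (C * a ^+ 2) ^+ 2.
    apply: (le_trans w2); have -> : e * KK = C0 * (a ^+ 2) ^+ 2 by rewrite /e /KK /C0; ring.
    have -> : (C * a ^+ 2) ^+ 2 = C ^+ 2 * (a ^+ 2) ^+ 2 by ring.
    apply: ler_wpM2r; first exact: sqr_ge0.
    by apply: CC => //; rewrite /C0 mulrDr; lra.
  by rewrite -[w r ^+ 2]real_normK ?num_real// ler_pXn2r ?nnegrE.
Qed.

End scaled_slope.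

(** Every exponent of [kappa] in the estimates is a multiple of one quarter; with [a] they become
    integer powers, open to [ring] and [field]. *)
Lemma fourth_root (R : realType) (kappa : R) : 0 < kappa ->
  let a := kappa `^ (1 / 4) in
  [/\ 0 < a, kappa = a ^+ 4, kappa `^ (3 / 4) = a ^+ 3, kappa `^ (1 / 2) = a ^+ 2 &
      Num.sqrt kappa = a ^+ 2].
Proof.
move=> k0 a; have a0 : 0 < a by rewrite powR_gt0.
have aX (j : nat) : a ^+ j = kappa `^ (j%:R / 4).
  by rewrite -powR_mulrn ?(ltW a0)// /a -powRrM; congr (_ `^ _); ring.
have a4 : kappa = a ^+ 4 by rewrite aX divff// powRr1// ltW.
split.
- exact: a0.
- exact: a4.
- by rewrite aX.
- by rewrite aX; congr (_ `^ _); field.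
- have -> : kappa = (a ^+ 2) ^+ 2 by rewrite [LHS]a4 -exprM.
  by rewrite sqrtr_sqr ger0_norm// sqr_ge0.
Qed.

Unset Implicit Arguments.

Theorem theorem1p3 (R : realType) (n : nat) (gamma rho_plus : R)
    (hn : (2 <= n)%N) (hgamma : 1 <= gamma) (hrho_plus : 0 < rho_plus) :
  (forall rho_b : R,
     exists C : R, 0 < C /\
       forall (kappa : R) (rho : R -> R), 0 < kappa ->
         stationary_solution n gamma rho_plus kappa rho_b rho ->
         [/\ (L2r_norm n (fun r => rho r - rho_plus)%R
                <= (C * kappa `^ (3 / 4))%:E)%E,
             (L2r_norm n (rho^`())%classic <= (C * kappa `^ (1 / 4))%:E)%E
           & (Linfty_norm (fun r => rho r - rho_plus)%R
                <= (C * kappa `^ (1 / 2))%:E)%E])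
  /\
  (exists delta : R, 0 < delta /\
     forall rho_b0 : R, `|rho_b0| < delta ->
       exists rhobar : R -> R,
         [/\ layer_solution gamma rho_plus rho_b0 rhobar,
             forall rhobar' : R -> R,
               layer_solution gamma rho_plus rho_b0 rhobar' ->
               forall y : R, 0 <= y -> rhobar' y = rhobar y
           & forall kappa_max : R, 0 < kappa_max ->
               exists C : R, 0 < C /\
                 forall (kappa : R) (rho : R -> R),
                   0 < kappa -> kappa <= kappa_max ->
                   stationary_solution n gamma rho_plus kappa
                     (rho_b0 / Num.sqrt kappa) rho ->
                   let w := fun r => rho r - rescaled_layer kappa rhobar r in
                   [/\ (L2r_norm n w <= (C * kappa `^ (3 / 4))%:E)%E,
                       (L2r_norm n (w^`())%classic <= (C * kappa `^ (1 / 4))%:E)%E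
                     & (Linfty_norm w <= (C * kappa `^ (1 / 2))%:E)%E]]).
Proof.
split=> [rho_b|].
  have [C C0 hC] := fixed_slope_estimates rho_b hn hgamma hrho_plus.
  exists C; split=> // kappa rho /fourth_root[a0 k4 k3 k2 _] sol.
  by rewrite k3 k2; apply: hC => //; rewrite -k4.
have p2 : 0 < rho_plus / 2 by rewrite divr_gt0.
have [c c0 hc] := enthalpy_coercive hgamma hrho_plus.
have [H [Hp dH]] := enthalpy_potential_exists gamma hrho_plus.
(* [sqrt D] meets the smallness condition on [d] with equality; it serves as the threshold for the
   scaled slope. *)
pose D : R := c / 2 * (rho_plus / 2) ^+ 2 / (1 + rho_plus / 2).
have p21 : 0 < 1 + rho_plus / 2 by rewrite addr_gt0.
have D0 : 0 < D by rewrite divr_gt0// mulr_gt0 ?divr_gt0// exprn_gt0.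
have dq : Num.sqrt D ^+ 2 * (1 + rho_plus / 2) <= c / 2 * (rho_plus / 2) ^+ 2.
  by rewrite sqr_sqrtr ?(ltW D0)// /D divfK// gt_eqF.
exists (Num.sqrt D); split=> [|b bd]; first by rewrite sqrtr_gt0.
have [s [s1 [l [A [l0 A0 s10 ds sB]]]]] :=
  layer_profile hgamma hrho_plus c0 Hp dH hc dq bd.
have ssol := layer_solution_of_profile hrho_plus l0 s10 ds sB.
exists s; split => //.
  by move=> s' /(layer_solution_unique hgamma ssol).
move=> km km0; have [am0 _ _ _ _] := fourth_root km0.
(* The constant depends on [kappa_max] through its fourth root, the upper bound imposed on [a]. *)
have [C C0 hC] := scaled_slope_estimates n hgamma hrho_plus l0 A0 s10 ds sB am0.
exists C; split=> // kappa rho k0 kkm; have [a0 k4 k3 k2 sq] := fourth_root k0.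
rewrite k3 k2 sq {1}k4 => sol; rewrite /rescaled_layer sq; apply: hC => //.
  by rewrite ge0_ler_powR ?nnegrE ?divr_ge0// ltW.
exact: (stationary_close hgamma hrho_plus c0 a0 Hp dH hc dq bd sol).
Qed.
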